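(* Let $n\ge 1$, $0<s_1<\cdots<s_n<t\le T$ and $(y_1,\dots,y_n)\in\mathbb{R}^n$. Put $$Q_{s_1\ldots s_n}(y_1,\dots,y_n)=q_{s_1}(y_1)\,q_{s_2-s_1}(y_2-y_1)\cdots q_{s_n-s_{n-1}}(y_n-y_{n-1}).$$ Then $$\Bigl[\bigl(Q_{s_1\ldots s_n}\bigr)^{-1}\frac{\partial^n Q_{s_1\ldots s_n}}{\partial y_n\cdots\partial y_1}\Bigr](y_1,\dots,y_n)=(-1)^n\,\mathbb{E}\bigl(\Lambda_{s_1\ldots s_n}\,\big|\,W_{s_1}=y_1,\dots,W_{s_n}=y_n\bigr),$$ where $\Lambda_{s_1\ldots s_n}$ is the iterated divergence defined in the context.
   Context: Fix $T>0$. $\Omega$ is the space of continuous paths $[0,T]\to\mathbb{R}$ with Wiener measure, and $(W_t)_{t\in[0,T]}$ is the canonical one-dimensional standard Brownian motion started at $0$. The heat kernel is $q_t(x)=\frac{e^{-x^2/(2t)}}{\sqrt{2\pi t}}$, $t>0$, $x\in\mathbb{R}$. The Cameron–Martin space is $H=\{h\in\Omega: h(0)=0,\ h \text{ absolutely continuous},\ \int_0^T|\dot h(s)|^2ds<\infty\}$ with $\langle h_1,h_2\rangle_H=\int_0^T\dot h_1\dot h_2\,ds$. $D_hF=\langle\nabla F,h\rangle_H$ is the (Malliavin) derivative of $F$ along $h$, i.e. the derivative at $\varepsilon=0$ of $F(w+\varepsilon h)$, and $\delta$ is the divergence operator, the adjoint of $\nabla$: $\mathbb{E}(\langle\nabla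 F,Z\rangle_H)=\mathbb{E}(F\,\delta(Z))$. In particular, for deterministic $h\in H$, $\delta(h)=\int_0^T\dot h(s)\,dW_s$, and for a smooth functional $G$, $\delta(Gh)=G\,\delta(h)-D_hG$. For pairwise distinct positive times $s_1,\dots,s_n$, let $\sigma_F=(s_i\wedge s_j)_{1\le i,j\le n}$ (the Malliavin covariance matrix of $F=(W_{s_1},\dots,W_{s_n})$), let $\sigma_F^{-1}=(\sigma^{-1}_{ij})_{i,j}$ be its inverse, and for $j=1,\dots,n$ let $h_j\in H$ be $h_j(\tau)=\sum_{i=1}^n\sigma^{-1}_{ij}\,(s_i\wedge\tau)$, $\tau\in[0,T]$. Define $$\Lambda_{s_1\ldots s_n}=\delta\bigl(h_n\,\delta(h_{n-1}\cdots\delta(h_2\,\delta(h_1))\cdots)\bigr),$$ i.e. $\Lambda^{(1)}=\delta(h_1)$, $\Lambda^{(k)}=\delta(h_k\Lambda^{(k-1)})$ for $2\le k\le n$, and $\Lambda_{s_1\ldots s_n}=\Lambda^{(n)}$. *)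

(* Defs.v *)
From HB Require Import structures.
From mathcomp Require Import all_boot all_order all_algebra.
From mathcomp Require Import all_classical all_reals all_analysis.

Set Implicit Arguments.
Unset Strict Implicit.
Unset Printing Implicit Defensive.

Import Order.TTheory GRing.Theory Num.Theory.
Import numFieldNormedType.Exports.

Local Open Scope classical_set_scope.
Local Open Scope ring_scope.

Section path_space.
Variables (R : realType) (T : R).

(* A path is a continuous function on [0, T]; it is represented by its
   extension by 0 to the real line, so that Leibniz equality of paths is
   equality on [0, T]. *)
Definition paths : {pred R -> R} :=
  mem [set w : R -> R | {within `[0, T], continuous w} /\
                        forall u : R, u \notin `[0, T] -> w u = 0].

Lemma pathsP (w : R -> R) :
  reflect ({within `[0, T], continuous w} /\
           forall u : R, u \notin `[0, T] -> w u = 0) (w \in paths).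
Proof. by apply: (iffP idP) => [/set_mem|?]; [|exact/mem_set]. Qed.

Lemma paths_submod_closed : submod_closed paths.
Proof.
split=> [|a w v /pathsP[wc w0] /pathsP[vc v0]]; apply/pathsP.
  by split=> // x; exact: cvg_cst.
split=> [x|u u0]; last first.
  by rewrite -[LHS]/(a * w u + v u) w0// v0// mulr0 addr0.
by apply: cvgD; [apply: cvgZr; exact: wc|exact: vc].
Qed.

HB.instance Definition _ :=
  GRing.isSubmodClosed.Build R (R -> R) paths paths_submod_closed.

Record path_space := Path { path_fun :> R -> R ; _ : path_fun \in paths }.

HB.instance Definition _ := [isSub for path_fun].
HB.instance Definition _ := [Choice of path_space by <:].
HB.instance Definition _ := [SubChoice_isSubLmodule of path_space by <:].
HB.instance Definition _ := isPointed.Build path_space 0.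

Definition path_cylinders : set (set path_space) :=
  [set A | exists2 u : R, u \in `[0, T] &
             exists2 B : set R, measurable B & A = [set w : path_space | B (w u)]].

HB.instance Definition _ :=
  Measurable.copy path_space (g_sigma_algebraType path_cylinders).

(* u |-> r /\ u on [0, T] *)
Lemma min_path_subproof (r : R) :
  (fun u => Num.min r u) \_ `[0, T] \in paths.
Proof.
apply/pathsP; split=> [|u u0]; last first.
  by rewrite patchE ifF//; apply/negbTE; rewrite mem_setE.
apply: (@subspace_eq_continuous _ _ _ (fun u : R => Num.min r u)).
  by move=> x xA; rewrite /from_subspace patchE xA.
apply: continuous_subspaceT => x.
by apply: continuous_min; [exact: cvg_cst|exact: cvg_id].
Qed.

Definition min_path (r : R) : path_space := Path (min_path_subproof r).

End path_space.

Section wiener.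
Variables (R : realType) (T : R).
Implicit Type P : probability (path_space T) R.

Definition wiener_measure P :=
  [/\ P [set w | w 0 = 0] = 1%E,
      forall r u : R, 0 <= r -> r < u -> u <= T ->
        forall B : set R, measurable B ->
          P [set w | B (w u - w r)] = normal_prob 0 (Num.sqrt (u - r)) B
    & forall (m : nat) (u : nat -> R),
        0 <= u 0%N -> (forall i, (i < m)%N -> u i < u i.+1) -> u m <= T ->
        forall B : nat -> set R, (forall i, measurable (B i)) ->
          P (\bigcap_(i < m) [set w | B i (w (u i.+1) - w (u i))]) =
          (\prod_(i < m) P [set w | B i (w (u i.+1) - w (u i))]%R)%E].

Definition abs_continuous (h : R -> R) :=
  forall e : R, 0 < e -> exists2 d : R, 0 < d &
    forall (m : nat) (a b : 'I_m -> R),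
      (forall i, [/\ 0 <= a i, a i <= b i & b i <= T]) ->
      (forall i j, i != j -> `]a i, b i[ `&` `]a j, b j[ = set0) ->
      \sum_i (b i - a i) < d -> \sum_i `|h (b i) - h (a i)| < e.

(* derive1 is total; it is meaningful a.e. when h is absolutely
   continuous. *)
Definition cm_sqnorm (h : R -> R) : \bar R :=
  (\int[lebesgue_measure]_(u in `[0%R, T]) ((derive1 h u) ^+ 2)%:E)%E.

Definition cameron_martin : set (path_space T) :=
  [set h | [/\ h 0 = 0, abs_continuous h & (cm_sqnorm h < +oo)%E]].

Definition partial n (f : 'rV[R]_n -> R) (i : 'I_n) : 'rV[R]_n -> R :=
  'D_(delta_mx 0 i) f.

(* The leftmost index is differentiated first. *)
Definition partials n (f : 'rV[R]_n -> R) (l : seq 'I_n) : 'rV[R]_n -> R :=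
  foldl (@partial n) f l.

Definition smooth_bounded n (f : 'rV[R]_n -> R) :=
  forall l : seq 'I_n, (forall x, differentiable (partials f l) x) /\
                       exists M : R, forall x, `|partials f l x| <= M.

Definition coords n (u : 'I_n -> R) (w : path_space T) : 'rV[R]_n :=
  \row_i w (u i).

Definition smooth_cylindrical (F : path_space T -> R) :=
  exists m (u : 'I_m -> R) (f : 'rV[R]_m -> R),
    [/\ forall i, u i \in `[0, T], smooth_bounded f & F = f \o coords u].

(* D_h F, that is <grad F, h>_H *)
Definition malliavin_derive (F : path_space T -> R) (h w : path_space T) : R :=
  derive1 (fun e : R => F (w + e *: h)) 0.

(* X is the divergence of the H-valued functional Z, for the divergence as the
   adjoint of the gradient from L^2(P) to L^2(P; H).  It suffices to test
   duality on smooth cylindrical functionals, which form a core of the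
   gradient, and for which <grad F, Z>_H at w is the derivative of F at w along
   the path Z w.  The integrability clause stands for the measurability of Z;
   when Z is measurable it follows from the second clause. *)
Definition is_divergence P (Z : path_space T -> path_space T)
    (X : path_space T -> R) :=
  [/\ forall w, cameron_martin (Z w),
      (\int[P]_w cm_sqnorm (Z w) < +oo)%E,
      X \in Lfun P 2%:E
    & forall F, smooth_cylindrical F ->
        P.-integrable setT (fun w => (malliavin_derive F (Z w) w)%:E) /\
        ('E_P[fun w => malliavin_derive F (Z w) w] = 'E_P[(F \* X)%R])%E].

(* The divergence is unique up to P-null sets; junk value 0 outside of the
   domain. *)
Definition divergence P (Z : path_space T -> path_space T) :
    path_space T -> R :=
  xget (cst 0) [set X | is_divergence P Z X].

Definition malliavin_cov n (s : 'I_n -> R) : 'M[R]_n :=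
  \matrix_(i, j) Num.min (s i) (s j).

Definition dual_path n (s : 'I_n -> R) (j : 'I_n) : path_space T :=
  \sum_i invmx (malliavin_cov s) i j *: min_path T (s i).

(* Starting the iteration at 1 gives divergence (dual_path s 0) after one
   step. *)
Definition Lambda P n (s : 'I_n -> R) : path_space T -> R :=
  foldl (fun G j => divergence P (fun w => G w *: dual_path s j))
        (cst 1) (enum 'I_n).

(* m is a version of y |-> E(X | Y = y) *)
Definition cond_exp_version P n (X : path_space T -> R)
    (Y : path_space T -> 'rV[R]_n) (m : 'rV[R]_n -> R) :=
  [/\ P.-integrable setT (EFin \o X),
      P.-integrable setT (EFin \o m \o Y)
    & forall B : set 'rV[R]_n, <<s [set U : set 'rV[R]_n | open U] >> B ->
        (\int[P]_(w in Y @^-1` B) (X w)%:E =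
         \int[P]_(w in Y @^-1` B) (m (Y w))%:E)%E].

(* E(X | Y = y) for every y, as the value at y of the continuous version; it is
   unique when the law of Y has full support. *)
Definition cond_exp P n (X : path_space T -> R)
    (Y : path_space T -> 'rV[R]_n) : 'rV[R]_n -> R :=
  xget (cst 0) [set m | continuous m /\ cond_exp_version P X Y m].

Definition heat_kernel (t x : R) : R :=
  expR (- x ^+ 2 / (2 * t)) / Num.sqrt (2 * pi * t).

(* v_{i-1}, with the convention that the value before the first index is 0 *)
Definition prev_coord n (v : 'I_n -> R) (i : 'I_n) : R :=
  \sum_(j < n | j.+1 == i) v j.

Definition Qdensity n (s : 'I_n -> R) (y : 'rV[R]_n) : R :=
  \prod_(i < n) heat_kernel (s i - prev_coord s i) (y 0 i - prev_coord (y 0) i).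

End wiener.

(* Main.v *)
Require Import Defs.
From mathcomp Require Import all_boot all_order all_algebra.
From mathcomp Require Import all_classical all_reals all_analysis.
From mathcomp Require Import measurable_realfun.
From mathcomp Require Import ring lra.

Import Order.TTheory GRing.Theory Num.Theory.
Import numFieldNormedType.Exports.

Local Open Scope classical_set_scope.
Local Open Scope ring_scope.

Set Implicit Arguments.
Unset Strict Implicit.
Unset Printing Implicit Defensive.

(**
Write $W_s = (W_{s_1}, \dots, W_{s_n})$ and $\ell_j(y) = \sum_i \sigma^{-1}_{ij} y_i$.
Both sides of the identity are governed by one first order recursion on
polynomials,
$p_0 = 1$, $p_j = \ell_j p_{j-1} - \partial_j p_{j-1}$.

On the analytic side, $Q$ is a constant times $\exp(-\mathcal{E}(y, y)/2)$ where
$\mathcal{E}(x, y) = \sum_i z_i(x) z_i(y) / \tau_i$ with $z_i(y) = y_i - y_{i-1}$ and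
$\tau_i = s_i - s_{i-1}$ [QdensityE].  The increments of the $k$-th row of $\sigma$
are $\tau_i 1_{i \le k}$, so that a telescoping sum gives
$\mathcal{E}(c \sigma, y) = \sum_k c_k y_k$ [energy_mul_cov]: the energy form is the inverse of
$\sigma$.  Hence $\partial_j Q = - \ell_j Q$, and the product rule turns the
iterated derivative of $Q$ into $(-1)^n p_n Q$ [partials_Qdensity].

On the probabilistic side, the divergence of $g(W_s) h_j$ is
$g(W_s) \ell_j(W_s) - D_{h_j} (g(W_s))$ for every polynomial $g$ [is_divergence_span],
and $D_{h_j} (g(W_s)) = (\partial_j g)(W_s)$ because $h_j(s_k) = \delta_{jk}$
[coords_dual_path].  Since the divergence is unique up to null sets
[is_divergence_unique], $\Lambda = p_n(W_s)$ almost surely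
[iterated_divergence_ae].  So $p_n$ is a continuous version of the conditional
expectation, and it is the only one because the law of $W_s$ charges every
nonempty open set [coords_open_gt0, cond_exp_unique].

The analytic core is the duality
$E[D_h \Phi] = E[\Phi\, \delta(h)]$ for $\Phi = \phi(W_u)$ and $h$ a combination of the
paths $r \wedge \cdot$ [ibp_span].  On a partition of $[0, T]$ containing all the
times involved, the paths $r \wedge \cdot$ are combinations of shifts of single
increments; an increment is a centred Gaussian variable independent of the
other ones [increment_indep], so that after conditioning on these the duality is the
integration by parts $E[\psi'(\xi)] = E[\xi \psi(\xi)] / \tau$ on the line
[gaussian_stein].  Uniqueness of the divergence rests on the density of smooth
cylindrical functionals [smooth_cylindrical_dense]: products of logistic
functions of the values of the path approximate the indicators of a
pi-system generating the sigma-algebra.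
*)

(** * Gaussian moments and integration by parts on the line *)

Definition poly_growth (R : realType) (V : normedZmodType R) (f : V -> R) :=
  exists C k, forall x, `|f x| <= C * (1 + `|x|) ^+ k.

Section gaussian.
Context {R : realType}.
Variable sigma : R.
Hypothesis sigma_gt0 : 0 < sigma.
Local Notation mu := (@lebesgue_measure R).
Local Notation g := (normal_pdf 0 sigma).
Local Notation N := (normal_prob 0 sigma).

Let sigma_neq0 : sigma != 0. Proof. by rewrite gt_eqF. Qed.

(** A polynomial is absorbed by doubling the standard deviation:
    $(1 + |x|)^k \le e^{k |x|}$, and $k |x| - 3 x^2 / (8 \sigma^2)$ is bounded above by
    completing the square. *)
Lemma normal_pdf_poly_le k : exists C, forall x,
  (1 + `|x|) ^+ k * g x <= C * normal_pdf 0 (2 * sigma) x.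
Proof.
have s20 : 2 * sigma != 0 by rewrite mulf_neq0.
(* The maximum of k z - 3 z^2 / (8 sigma^2) over z is 2 sigma^2 k^2 / 3. *)
exists (expR (k%:R ^+ 2 * (2 * sigma ^+ 2 / 3)) *
  (normal_peak sigma / normal_peak (2 * sigma))) => x.
rewrite !normal_pdfE// mulrCA -!mulrA [X in _ <= _ * X]mulrC -!mulrA.
rewrite (mulrC (normal_fun _ _ _)) (mulrA _ (normal_peak (2 * sigma))).
rewrite mulVf ?gt_eqF ?normal_peak_gt0// mul1r [leRHS]mulrCA.
rewrite ler_pM2l ?normal_peak_gt0// /normal_fun !subr0.
have h1 : (1 + `|x|) ^+ k <= expR (k%:R * `|x|).
  rewrite mulrC expRM_natr lerXn2r// ?nnegrE ?addr_ge0 ?expR_ge0//.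
  exact: expR_ge1Dx.
apply: le_trans (ler_wpM2r (expR_ge0 _) h1) _.
rewrite -!expRD ler_expR -subr_ge0 -!(real_normK (num_real x)).
set z := `|x|; rewrite -?[in LHS]mulNr.
rewrite (_ : _ - _ = 2 * sigma ^+ 2 / 3 * (k%:R - 3 * z / (4 * sigma ^+ 2)) ^+ 2); last first.
  by field.
by rewrite mulr_ge0 ?sqr_ge0// divr_ge0// mulr_ge0 ?sqr_ge0.
Qed.

Lemma integrable_poly_normal_pdf (f : R -> R) :
  measurable_fun setT f -> poly_growth f ->
  mu.-integrable setT (fun x => (f x * g x)%:E).
Proof.
move=> mf [C [k fC]]; have [D gD] := normal_pdf_poly_le k.
apply: (@le_integrable _ _ _ mu _ _ _
  (fun x => (C * D)%:E * (normal_pdf 0 (2 * sigma) x)%:E)%E) => //.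
- by apply/measurable_EFinP/measurable_funM => //; exact: measurable_normal_pdf.
- move=> x _; rewrite -EFinM !abse_EFin lee_fin; apply: le_trans _ (ler_norm _).
  rewrite normrM (ger0_norm (normal_pdf_ge0 _ _ _)).
  have C0 : 0 <= C by have := fC 0; rewrite normr0 addr0 expr1n mulr1; exact: le_trans.
  apply: le_trans (ler_wpM2r (normal_pdf_ge0 _ _ _) (fC x)) _.
  by rewrite -!mulrA ler_wpM2l.
- by apply: integrableZl => //; exact: integrable_normal_pdf.
Qed.

(** The normal law is defined by its density, which is therefore its
    Radon-Nikodym derivative; this transports integrals to Lebesgue measure. *)
Let rn_normal_pdf :
  ae_eq mu setT (Radon_Nikodym_SigmaFinite.f N mu) (fun x => (g x)%:E).
Proof.
apply: integral_ae_eq => //.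
- exact/Radon_Nikodym_SigmaFinite.f_integrable/normal_prob_dominates.
- by apply/measurable_EFinP; exact: measurable_normal_pdf.
- move=> E _ mE; rewrite -Radon_Nikodym_SigmaFinite.f_integral//.
  exact: normal_prob_dominates.
Qed.

Lemma ge0_integral_normal_prob (f : R -> \bar R) :
  measurable_fun setT f -> (forall x, 0 <= f x)%E ->
  (\int[N]_x f x = \int[mu]_x (f x * (g x)%:E))%E.
Proof.
move=> mf f0.
rewrite -(Radon_Nikodym_SigmaFinite.change_of_variables (normal_prob_dominates 0 sigma))//.
apply: ae_eq_integral => //.
- apply: emeasurable_funM => //; apply: (measurable_int mu).
  exact/Radon_Nikodym_SigmaFinite.f_integrable/normal_prob_dominates.
- apply: emeasurable_funM => //=; apply/measurableT_comp => //=.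
  exact: measurable_normal_pdf.
- exact: ae_eqe_mul2l.
Qed.

Lemma poly_growth_integrable_normal (f : R -> R) :
  measurable_fun setT f -> poly_growth f ->
  N.-integrable setT (EFin \o f).
Proof.
move=> mf pf; have mEf : measurable_fun setT (EFin \o f) by exact/measurable_EFinP.
apply/integrableP; split => //.
rewrite ge0_integral_normal_prob//; last exact: measurableT_comp.
have /integrableP[_] := integrable_poly_normal_pdf mf pf.
under eq_integral => x _.
  rewrite EFinM abseM (@gee0_abs _ (g x)%:E) ?lee_fin ?normal_pdf_ge0//.
  over.
by [].
Qed.

Lemma integral_normal_prob (f : R -> R) :
  measurable_fun setT f -> poly_growth f ->
  (\int[N]_x (f x)%:E = \int[mu]_x (f x * g x)%:E)%E.
Proof.
move=> mf pf; have fi := poly_growth_integrable_normal mf pf.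
have mEf : measurable_fun setT (EFin \o f) by exact/measurable_EFinP.
rewrite -(Radon_Nikodym_change_of_variables (normal_prob_dominates 0 sigma))//=.
apply: ae_eq_integral => //.
- apply: emeasurable_funM => //; apply: (measurable_int mu).
  by apply: Radon_Nikodym_integrable; exact: normal_prob_dominates.
- by apply/measurable_EFinP/measurable_funM => //; exact: measurable_normal_pdf.
- under [X in ae_eq _ _ _ X]eq_fun do rewrite EFinM.
  apply: ae_eqe_mul2l; apply: ae_eq_trans rn_normal_pdf.
  apply/ae_eq_sym; apply: ae_eq_Radon_Nikodym_SigmaFinite => //.
  exact: normal_prob_dominates.
Qed.

Lemma poly_growth_mul_normal_pdf_cvg (f : R -> R) : poly_growth f ->
  f (n%:R) * g (n%:R) @[n --> \oo] --> (0 : R) /\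
  f (- n%:R) * g (- n%:R) @[n --> \oo] --> (0 : R).
Proof.
move=> [C [k fC]]; have [D gD] := normal_pdf_poly_le k.+1.
have C0 : 0 <= C by have := fC 0; rewrite normr0 addr0 expr1n mulr1; exact: le_trans.
set M := C * (D * normal_peak (2 * sigma)).
have h x : `|f x * g x| <= M * (1 + `|x|)^-1.
  rewrite ler_pdivlMr ?ltr_pwDl// normrM (ger0_norm (normal_pdf_ge0 _ _ _)).
  have : `|f x| * g x * (1 + `|x|) <= C * ((1 + `|x|) ^+ k.+1 * g x).
    rewrite exprSr [_ * (1 + _) * g x]mulrAC !mulrA ler_wpM2r ?addr_ge0//.
    by rewrite ler_wpM2r ?normal_pdf_ge0//.
  move/le_trans; apply; rewrite /M ler_wpM2l//; apply: le_trans (gD x) _.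
  have D0 : 0 <= D.
    have := gD 0; rewrite normr0 addr0 expr1n mul1r => /(le_trans (normal_pdf_ge0 _ _ _)).
    by rewrite pmulr_lge0// normal_pdfE ?mulf_neq0// mulr_gt0 ?expR_gt0// normal_peak_gt0// mulf_neq0.
  by rewrite ler_wpM2l// normal_pdf_ub// mulf_neq0.
have l0 : M * (1 + n%:R)^-1 @[n --> \oo] --> (0 : R).
  rewrite -[X in _ --> X](mulr0 M); apply: cvgM; first exact: cvg_cst.
  rewrite [X in X @ _](_ : _ = @harmonic R); first exact: cvg_harmonic.
  by apply/funext => n; rewrite /= nat1r.
split; apply: norm_cvg0; apply: (squeeze_cvgr _ (cvg_cst 0) l0);
  apply: nearW => n; rewrite normr_ge0 /=.
  by have := h n%:R; rewrite normr_nat.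
by have := h (- n%:R); rewrite normrN normr_nat.
Qed.

End gaussian.

Section poly_growth.
Context {R : realType}.

Lemma poly_growthD (V : normedZmodType R) (f g : V -> R) :
  poly_growth f -> poly_growth g -> poly_growth (f \+ g).
Proof.
move=> [C [k fC]] [D [l gD]].
have C0 : 0 <= C by have := fC 0; rewrite normr0 addr0 expr1n mulr1; exact: le_trans.
have D0 : 0 <= D by have := gD 0; rewrite normr0 addr0 expr1n mulr1; exact: le_trans.
exists (C + D), (k + l)%N => x; rewrite (le_trans (ler_normD _ _))// mulrDl lerD//.
  by rewrite (le_trans (fC x))// ler_wpM2l// ler_weXn2l ?leq_addr// lerDl.
by rewrite (le_trans (gD x))// ler_wpM2l// ler_weXn2l ?leq_addl// lerDl.
Qed.

Lemma poly_growthM (V : normedZmodType R) (f g : V -> R) :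
  poly_growth f -> poly_growth g -> poly_growth (f \* g).
Proof.
move=> [C [k fC]] [D [l gD]]; exists (C * D), (k + l)%N => x.
by rewrite normrM exprD mulrACA ler_pM.
Qed.

Lemma poly_growth_bounded (V : normedZmodType R) (f : V -> R) M :
  (forall x, `|f x| <= M) -> poly_growth f.
Proof. by move=> fM; exists M, 0%N => x; rewrite expr0 mulr1. Qed.

Lemma poly_growth_cst (V : normedZmodType R) c : poly_growth (cst c : V -> R).
Proof. exact: (@poly_growth_bounded _ _ `|c|). Qed.

Lemma poly_growth_le (V : normedZmodType R) (f : V -> R) C :
  0 <= C -> (forall x, `|f x| <= C * `|x|) -> poly_growth f.
Proof.
move=> C0 fC; exists C, 1%N => x; rewrite (le_trans (fC x))// ler_wpM2l//.
by rewrite expr1 lerDr.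
Qed.

Lemma poly_growth_comp (V W : normedZmodType R) (f : V -> R) (h : W -> V) C :
  0 <= C -> (forall x, `|h x| <= C * (1 + `|x|)) -> poly_growth f -> poly_growth (f \o h).
Proof.
move=> C0 hC [D [k fD]]; exists (D * (1 + C) ^+ k), k => x.
have D0 : 0 <= D by have := fD 0; rewrite normr0 addr0 expr1n mulr1; exact: le_trans.
rewrite (le_trans (fD _))// -mulrA -exprMn ler_wpM2l// lerXn2r ?nnegrE ?addr_ge0//.
  by rewrite mulr_ge0// addr_ge0.
by rewrite mulrDl mul1r lerD// lerDl.
Qed.

End poly_growth.

Section stein.
Context {R : realType}.
Variable sigma : R.
Hypothesis sigma_gt0 : 0 < sigma.
Local Notation mu := (@lebesgue_measure R).
Local Notation g := (normal_pdf 0 sigma).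
Local Notation N := (normal_prob 0 sigma).

Let sigma_neq0 : sigma != 0. Proof. by rewrite gt_eqF. Qed.

Lemma is_derive_normal_pdf (x : R) :
  is_derive x 1 g (- (x / sigma ^+ 2) * g x).
Proof.
rewrite normal_pdfE// /normal_fun.
apply: is_derive_eq; rewrite /GRing.scale/= !subr0.
by field.
Qed.

(** The derivative of $F = \psi g$, with $g$ the density, is
    $(\psi' - x \psi / \sigma^2) g$.  Its integral over $[-N, N]$ is $F(N) - F(-N)$, which
    tends to 0, and dominated convergence lets $N$ tend to infinity. *)
Lemma gaussian_stein (psi : R -> R) :
  (forall x, derivable psi x 1) -> continuous (derive1 psi) ->
  poly_growth psi -> poly_growth (derive1 psi) ->
  (\int[N]_x (derive1 psi x)%:E = \int[N]_x (x / sigma ^+ 2 * psi x)%:E)%E.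
Proof.
move=> dpsi cpsi' ppsi ppsi'.
have cpsi : continuous psi.
  by move=> x; apply/differentiable_continuous/derivable1_diffP.
have cg : continuous g by exact: continuous_normal_pdf.
have m1 : measurable_fun setT (derive1 psi) by exact: continuous_measurable_fun.
pose xpsi (x : R) := x / sigma ^+ 2 * psi x.
have cxpsi : continuous xpsi.
  by move=> x; apply: cvgM; [apply: cvgM; [exact: cvg_id|exact: cvg_cst]|exact: cpsi].
have m2 : measurable_fun setT xpsi by exact: continuous_measurable_fun.
have pxpsi : poly_growth xpsi.
  apply: poly_growthM => //; apply: (@poly_growth_le _ _ _ (sigma ^- 2)) => [|x].
    by rewrite invr_ge0 sqr_ge0.
  by rewrite mulrC normrM ger0_norm// invr_ge0 sqr_ge0.
pose f0 := derive1 psi \- xpsi.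
have pf0 : poly_growth f0.
  apply: poly_growthD => //; case: pxpsi => C [k h]; exists C, k => x.
  by rewrite normrN.
have cf0 : continuous f0 by move=> x; apply: cvgB; [exact: cpsi'|exact: cxpsi].
have mf0 : measurable_fun setT f0 by exact: continuous_measurable_fun.
suff h : (\int[mu]_x (f0 x * g x)%:E = 0)%E.
  move: h; rewrite -integral_normal_prob//.
  under eq_integral do rewrite EFinB.
  rewrite integralB//; last 2 first.
  - exact: poly_growth_integrable_normal.
  - exact: poly_growth_integrable_normal.
  have /fineK <- := integrable_fin_num measurableT (poly_growth_integrable_normal sigma_gt0 m1 ppsi').
  have /fineK <- := integrable_fin_num measurableT (poly_growth_integrable_normal sigma_gt0 m2 pxpsi).
  by rewrite -EFinB => -[] /eqP; rewrite subr_eq0 => /eqP ->.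
pose F x := psi x * g x.
have dF (x : R) : is_derive x 1 F (f0 x * g x).
  have dg := is_derive_normal_pdf x.
  have dp : is_derive x 1 psi (derive1 psi x) by rewrite derive1E; exact/derivableP.
  apply: is_derive_eq; rewrite /GRing.scale/= /f0 /xpsi/=; ring.
have FTC n : (\int[mu]_(x in `[(- n.+1%:R)%R, n.+1%:R]) (f0 x * g x)%:E =
    (F n.+1%:R)%:E - (F (- n.+1%:R))%:E)%E.
  have cF : continuous F.
    by move=> x; apply/differentiable_continuous/derivable1_diffP; case: (dF x).
  apply: continuous_FTC2.
  - by rewrite (@lt_trans _ _ 0)// oppr_lt0.
  - apply: continuous_subspaceT => x; apply: cvgM; [exact: cf0|exact: cg].
  - split=> [x _| |]; first by case: (dF x).
    + apply: cvg_at_right_filter; exact: cF.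
    + apply: cvg_at_left_filter; exact: cF.
  - by move=> x _; rewrite derive1E; exact: derive_val.
pose D n : set R := `[(- n.+1%:R)%R, n.+1%:R]%classic.
have mf0g : measurable_fun setT (fun x => (f0 x * g x)%:E).
  by apply/measurable_EFinP/measurable_funM => //; exact: measurable_normal_pdf.
pose G n := (fun x => (f0 x * g x)%:E) \_ (D n).
have F0 : (F n.+1%:R - F (- n.+1%:R))%:E @[n --> \oo] --> (0 : \bar R).
  have [a b] := poly_growth_mul_normal_pdf_cvg sigma_gt0 ppsi.
  apply: cvg_EFin; first exact: nearW.
  rewrite -(subrr (0 : R)); apply: cvgB.
    by have := a; rewrite -(cvg_shiftS (fun n => psi n%:R * g n%:R)).
  by have := b; rewrite -(cvg_shiftS (fun n => psi (- n%:R) * g (- n%:R))).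
suff : (F n.+1%:R - F (- n.+1%:R))%:E @[n --> \oo] --> (\int[mu]_x (f0 x * g x)%:E)%E.
  by move=> h; apply: cvg_unique h F0.
rewrite [X in X @ _ --> _](_ : _ = [sequence (\int[mu]_x G n x)%E]_n); last first.
  apply/funext => n; rewrite EFinB -FTC [LHS]integral_mkcond; exact: eq_integral.
case: (@dominated_convergence _ _ _ mu setT measurableT G
  (fun x => (f0 x * g x)%:E) (fun x => `|(f0 x * g x)%:E|)%E) => //.
- move=> n; apply/(measurable_restrictT _ _).1; first exact: measurable_itv.
  exact: measurable_funTS.
- apply: nearW => x _; apply: cvg_near_cst; near=> n.
  rewrite /G patchE ifT//; apply/mem_set; rewrite /D/= in_itv/= -ler_norml.
  rewrite (@le_trans _ _ n%:R)// ?ler_nat//; near: n.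
  exact: nbhs_infty_ger.
- by apply: integrable_abse => //; exact: integrable_poly_normal_pdf.
- apply: nearW => x n _; rewrite /G patchE; case: ifPn => // _.
  by rewrite /= normr0 lee_fin.
Unshelve. all: by end_near. Qed.
End stein.

(** * Borel sets of row vectors, and independence *)

Section rV_measurable.
Context {R : realType} d (D : measurableType d) (n : nat).
Variable g : D -> 'rV[R]_n.
Hypothesis mg : forall i, measurable_fun setT (fun w => g w 0 i).

Let box (q : {ffun 'I_n -> rat} * nat) : set 'rV[R]_n :=
  [set y | forall i, `|ratr (q.1 i) - y 0 i| < q.2.+1%:R^-1].

Let measurable_box q : measurable (g @^-1` box q).
Proof.
have -> : g @^-1` box q = \bigcap_(i in [set: 'I_n])
    ((fun w => g w 0 i) @^-1` [set x | `|ratr (q.1 i) - x| < q.2.+1%:R^-1]).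
  by apply/seteqP; split=> [w h i _|w h i]; [exact: h|exact: h i I].
apply: fin_bigcap_measurable => // i _.
rewrite -[X in measurable X]setTI; apply: mg => //.
have -> : [set x | `|ratr (q.1 i) - x| < q.2.+1%:R^-1] = ball (ratr (q.1 i) : R) q.2.+1%:R^-1 by [].
exact: measurable_ball.
Qed.

(** Boxes with rational centres and radii $1/(k+1)$ are a countable base, and a box
    only constrains coordinates. *)
Lemma measurable_rV_open (U : set 'rV[R]_n) : open U -> measurable (g @^-1` U).
Proof.
move=> oU.
have -> : U = \bigcup_q (if `[< box q `<=` U >] then box q else set0).
  apply/seteqP; split => [y Uy|y [q _]]; last first.
    by case: ifPn => // /asboolP; exact.
  have /nbhs_ballP[e /= e0 yeU] : nbhs y U by exact: open_nbhs_nbhs.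
  have [k ke] : exists k : nat, k.+1%:R^-1 < e / 2.
    have /ltr_add_invr[k hk] : 0 < e / 2 by rewrite divr_gt0.
    by exists k; rewrite add0r in hk.
  have [q hq] : exists q : {ffun 'I_n -> rat}, forall i, `|ratr (q i) - y 0 i| < k.+1%:R^-1.
    have h i : exists r : rat, `|ratr r - y 0 i| < k.+1%:R^-1.
      have [|r] := @rat_in_itvoo _ (y 0 i - k.+1%:R^-1) (y 0 i + k.+1%:R^-1).
        by rewrite ltrD2l gt0_cp.
      by rewrite in_itv/= -ltr_distlC => hr; exists r; rewrite distrC.
    by exists [ffun i => sval (cid (h i))] => i; rewrite ffunE; case: cid.
  exists (q, k) => //; rewrite ifT; first by move=> i; exact: hq.
  apply/asboolP => z /= hz; apply: yeU; split=> // i j.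
  rewrite ord1; rewrite /ball /=.
  rewrite (le_lt_trans (ler_distD (ratr (q j)) _ _))// [ltRHS]splitr.
  by apply: ltrD; apply: (lt_trans _ ke); [rewrite distrC; exact: hq|exact: hz].
rewrite preimage_bigcup; apply: countable_bigcupT_measurable.
  exact: countableP.
by move=> q; case: ifP => _; [exact: measurable_box|rewrite preimage_set0].
Qed.

Lemma measurable_rV_borel (B : set 'rV[R]_n) :
  <<s [set U : set 'rV[R]_n | open U] >> B -> measurable (g @^-1` B).
Proof.
move: B; apply: smallest_sub; last by move=> U; exact: measurable_rV_open.
split => [|A mA|F mF].
- by rewrite /= preimage_set0.
- rewrite /= setTD preimage_setC; exact: measurableC.
- by rewrite /= preimage_bigcup; exact: bigcup_measurable.
Qed.

Lemma continuous_rV_measurable (f : 'rV[R]_n -> R) :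
  continuous f -> measurable_fun setT (fun w => f (g w)).
Proof.
move=> /continuousP cf; apply: (measurability _ (RGenOpens.measurableE R)).
move=> _ [_ [a [b ->] <-]]; rewrite setTI.
have -> : (fun w => f (g w)) @^-1` `]a, b[ = g @^-1` (f @^-1` `]a, b[%classic) by [].
by apply: measurable_rV_open; apply: cf; exact: interval_open.
Qed.

End rV_measurable.

Section independence.
Context d d1 d2 {R : realType} (W : measurableType d) (T1 : measurableType d1)
  (T2 : measurableType d2) (P : probability W R) (mu : probability T1 R).
Variables (X : W -> T1) (Z : W -> T2).
Hypotheses (mX : measurable_fun setT X) (mZ : measurable_fun setT Z).
Hypothesis XZ : forall A B, measurable A -> measurable B ->
  P (X @^-1` A `&` Z @^-1` B) = (mu A * P (Z @^-1` B))%E.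

Let Zf : {mfun W >-> T2} := mfun_Sub (mem_set mZ).
Let XZf : {mfun W >-> (T1 * T2)%type} :=
  mfun_Sub (mem_set (measurable_fun_pair mX mZ)).

Let indep_fubini (f : T1 * T2 -> R) :
  measurable_fun setT f -> P.-integrable setT (fun w => (f (X w, Z w))%:E) ->
  (\int[P]_w (f (X w, Z w))%:E =
   \int[distribution P Zf]_z \int[mu]_x (f (x, z))%:E)%E.
Proof.
move=> mf fi.
have E A : measurable A -> (mu \x distribution P Zf)%E A = distribution P XZf A.
  apply: product_measure_unique => C D mC mD.
  exact: XZ.
have mEf : measurable_fun setT (EFin \o f) by exact/measurable_EFinP.
rewrite -(@integral_distribution _ _ _ _ _ P XZf (EFin \o f) mEf fi).
have E' (h : T1 * T2 -> \bar R) :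
    (\int[mu \x distribution P Zf]_z h z = \int[distribution P XZf]_z h z)%E.
  by apply: eq_measure_integral => A mA _; exact: E.
rewrite -E' -integral21_prod_meas1//; apply/integrableP; split => //.
rewrite E' ge0_integral_distribution//; last exact: measurableT_comp.
by case/integrableP : fi.
Qed.

(** Fubini for the joint law of the independent pair $(X, Z)$, in the form used to
    integrate by parts in one variable while the other one is frozen. *)
Lemma indep_eq_integral (f1 f2 : T1 * T2 -> R) :
  measurable_fun setT f1 -> measurable_fun setT f2 ->
  P.-integrable setT (fun w => (f1 (X w, Z w))%:E) ->
  P.-integrable setT (fun w => (f2 (X w, Z w))%:E) ->
  (forall z, \int[mu]_x (f1 (x, z))%:E = \int[mu]_x (f2 (x, z))%:E)%E ->
  (\int[P]_w (f1 (X w, Z w))%:E = \int[P]_w (f2 (X w, Z w))%:E)%E.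
Proof.
move=> m1 m2 i1 i2 f12; rewrite !indep_fubini//.
by apply: eq_integral => z _; exact: f12.
Qed.

End independence.

(** * Random variables with finite moments, tame functions *)

Section rV_norm.
Context {R : realType} {n : nat}.
Implicit Types x : 'rV[R]_n.

Lemma rV_coord_le_norm x i : `|x 0 i| <= `|x|.
Proof.
by rewrite [leRHS]/Num.norm /= mx_normrE; apply/bigmax_geP; right; exists (0, i).
Qed.

Lemma rV_norm_le_sum x : `|x| <= \sum_i `|x 0 i|.
Proof.
rewrite [leLHS]/Num.norm /= mx_normrE; apply: bigmax_le => [|[j i] _ /=].
  exact: sumr_ge0.
by rewrite ord1 (bigD1 i)//= lerDl sumr_ge0.
Qed.

Lemma rV_norm_le x (e : R) :
  0 <= e -> (forall i, `|x 0 i| <= e) -> `|x| <= e.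
Proof.
move=> e0 xe; rewrite [leLHS]/Num.norm /= mx_normrE.
by apply: bigmax_le => // -[j i] _ /=; rewrite ord1.
Qed.

End rV_norm.

Section moments.
Context d {R : realType} (W : measurableType d) (P : probability W R).

(** A class of integrable variables that is stable under products, which square
    integrability is not. *)
Definition all_moments (X : W -> R) := measurable_fun setT X /\
  forall k, P.-integrable setT (fun w => (`|X w| ^+ k)%:E).

Lemma all_moments_le (X Y : W -> R) : measurable_fun setT X ->
  (forall w, `|X w| <= `|Y w|) -> all_moments Y -> all_moments X.
Proof.
move=> mX XY [mY iY]; split => // k; apply: le_integrable (iY k) => //.
  by apply/measurable_EFinP/measurable_funX; exact: measurableT_comp.
move=> w _; rewrite lee_fin ger0_norm ?exprn_ge0// (le_trans _ (ler_norm _))//.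
by rewrite lerXn2r// nnegrE.
Qed.

Lemma all_moments_cst c : all_moments (cst c).
Proof.
split => // k; exact: (finite_measure_integrable_cst P (`|c| ^+ k) measurableT).
Qed.

Lemma all_moments_norm X : all_moments X -> all_moments (fun w => `|X w|).
Proof.
move=> H; apply: all_moments_le (H); last by move=> w; rewrite normr_id.
by case: H => mX _; exact: measurableT_comp.
Qed.

Lemma all_momentsM X Y : all_moments X -> all_moments Y -> all_moments (X \* Y).
Proof.
move=> [mX iX] [mY iY]; split => [|k]; first exact: measurable_funM.
apply: le_integrable (integrableD measurableT (iX (k * 2)%N) (iY (k * 2)%N)) => //.
  by apply/measurable_EFinP/measurable_funX/measurableT_comp/measurable_funM.
move=> w _; rewrite /=. rewrite lee_fin !exprM normrX normr_id normrM exprMn.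
apply: le_trans _ (ler_norm _); set a := `|X w| ^+ k; set b := `|Y w| ^+ k.
have : 0 <= (a - b) ^+ 2 by exact: sqr_ge0.
have : 0 <= a ^+ 2 by exact: sqr_ge0.
have : 0 <= b ^+ 2 by exact: sqr_ge0.
nra.
Qed.

Lemma all_momentsD X Y : all_moments X -> all_moments Y -> all_moments (X \+ Y).
Proof.
move=> [mX iX] [mY iY]; split => [|k]; first exact: measurable_funD.
have := integrableZl measurableT (2 ^+ k) (integrableD measurableT (iX k) (iY k)).
apply: le_integrable => //.
  by apply/measurable_EFinP/measurable_funX/measurableT_comp/measurable_funD.
move=> w _; rewrite /= lee_fin normrX normr_id.
apply: le_trans _ (ler_norm _).
have : `|X w + Y w| <= 2 * Num.max `|X w| `|Y w|.
  rewrite (le_trans (ler_normD _ _))// mulr_natl mulr2n lerD// le_max lexx ?orbT//.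
move=> h; apply: (@le_trans _ _ ((2 * Num.max `|X w| `|Y w|) ^+ k)).
  by rewrite lerXn2r// nnegrE ?mulr_ge0// le_max normr_ge0.
rewrite exprMn ler_wpM2l ?exprn_ge0//.
by case: (leP `|X w| `|Y w|) => _; rewrite ?lerDl ?lerDr exprn_ge0.
Qed.

Lemma all_moments_sum I (r : seq I) (X : I -> W -> R) :
  (forall i, all_moments (X i)) -> all_moments (fun w => \sum_(i <- r) X i w).
Proof.
move=> hX; elim: r => [|i r ih].
  by under eq_fun do rewrite big_nil; exact: all_moments_cst.
by under eq_fun do rewrite big_cons; exact: all_momentsD.
Qed.

Lemma all_momentsX X k : all_moments X -> all_moments (fun w => X w ^+ k).
Proof.
move=> hX; elim: k => [|k ih].
  by under eq_fun do rewrite expr0; exact: all_moments_cst.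
by under eq_fun do rewrite exprS; exact: all_momentsM.
Qed.

Lemma all_moments_integrable X : all_moments X -> P.-integrable setT (EFin \o X).
Proof.
move=> [mX iX]; apply: le_integrable (iX 1%N) => //; first exact/measurable_EFinP.
by move=> w _; rewrite lee_fin expr1 normr_id.
Qed.

Lemma all_moments_Lfun X : all_moments X -> X \in Lfun P 2%:E.
Proof.
move=> [mX iX]; apply/andP; split; first by rewrite inE.
rewrite inE/= /finite_norm; apply: (@lty_poweRy _ _ 2) => //.
rewrite poweR_Lnorm//; have /integrableP[_] := iX 2%N.
apply: le_lt_trans; rewrite le_eqVlt; apply/orP; left; apply/eqP.
by apply: eq_integral => w _ /=; rewrite powR_mulrn ?normr_ge0// normrX normr_id.
Qed.

Lemma poly_growth_all_moments n (f : 'rV[R]_n -> R) (Y : W -> 'rV[R]_n) :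
  continuous f -> poly_growth f -> (forall i, all_moments (fun w => Y w 0 i)) ->
  all_moments (fun w => f (Y w)).
Proof.
move=> cf [C [k fC]] hY.
have C0 : 0 <= C by have := fC 0; rewrite normr0 addr0 expr1n mulr1; exact: le_trans.
apply: (@all_moments_le _ (fun w => C * (1 + \sum_i `|Y w 0 i|) ^+ k)).
- by apply: continuous_rV_measurable => // i; case: (hY i).
- move=> w; apply: le_trans _ (ler_norm _); apply: le_trans (fC _) _.
  rewrite ler_wpM2l// lerXn2r ?nnegrE ?addr_ge0 ?sumr_ge0// lerD2l.
  exact: rV_norm_le_sum.
- apply: all_momentsM; first exact: all_moments_cst.
  apply: all_momentsX; apply: all_momentsD; first exact: all_moments_cst.
  by apply: all_moments_sum => i; exact: all_moments_norm.
Qed.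

End moments.

Section tame.
Context {R : realType}.

Lemma continuous_add (T : topologicalType) (f g : T -> R) :
  continuous f -> continuous g -> continuous (f \+ g).
Proof. by move=> cf cg x; exact: (cvgD (cf x) (cg x)). Qed.

Lemma continuous_mul (T : topologicalType) (f g : T -> R) :
  continuous f -> continuous g -> continuous (f \* g).
Proof. by move=> cf cg x; exact: (cvgM (cf x) (cg x)). Qed.

(** Contains both the polynomials and the bounded smooth functions, so that
    $\phi = f p$, with $f$ a test function and $p$ a polynomial, is covered by the
    integration by parts below. *)
Definition tame n (f : 'rV[R]_n -> R) :=
  [/\ forall x, differentiable f x, poly_growth f &
      forall v, continuous ('D_v f) /\ poly_growth ('D_v f)].

Section tame_theory.
Variable n : nat.
Implicit Types f g : 'rV[R]_n -> R.

Lemma tame_continuous f : tame f -> continuous f.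
Proof. by case=> df _ _ x; exact: differentiable_continuous. Qed.

(** Directional derivatives are read on lines, where one-variable calculus applies. *)
Lemma derive_line f (x v : 'rV[R]_n) (e : R) :
  'D_1 (fun e : R => f (x + e *: v)) e = 'D_v f (x + e *: v).
Proof.
rewrite /derive; set a := (X in lim (X @ _) = _).
set b := (X in _ = lim (X @ _)); suff -> : a = b by [].
apply/funext => h; rewrite /a/b/=.
by rewrite -[h *: 1]/(h * 1) mulr1 scalerDl addrCA.
Qed.

Lemma derivable_line f (x v : 'rV[R]_n) (e : R) :
  differentiable f (x + e *: v) -> derivable (fun e : R => f (x + e *: v)) e 1.
Proof.
move=> /(@diff_derivable _ _ _ _ _ v); rewrite /derivable.
set a := (X in cvg (X @ _) -> _); set b := (X in _ -> cvg (X @ _)).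
suff -> : a = b by [].
by apply/funext => h; rewrite /a/b/= -[h *: 1]/(h * 1) mulr1 scalerDl addrCA.
Qed.

Lemma derive_sum f x I (r : seq I) (v : I -> 'rV[R]_n) : differentiable f x ->
  'D_(\sum_(i <- r) v i) f x = \sum_(i <- r) 'D_(v i) f x.
Proof.
move=> df; rewrite deriveE// linear_sum; apply: eq_bigr => i _.
by rewrite deriveE.
Qed.

Lemma derive_scale f x (c : R) v : differentiable f x ->
  'D_(c *: v) f x = c * 'D_v f x.
Proof. by move=> df; rewrite !deriveE// linearZ. Qed.

Lemma derive_partial f x v : differentiable f x ->
  'D_v f x = \sum_i v 0 i * partial f i x.
Proof.
move=> df; rewrite [in LHS](row_sum_delta v) derive_sum//.
by apply: eq_bigr => i _; rewrite derive_scale.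
Qed.

Lemma tame_cst c : tame (cst c : 'rV[R]_n -> R).
Proof.
split=> [x||v]; [exact: differentiable_cst|exact: poly_growth_cst|].
rewrite (_ : 'D_v _ = cst 0); first by split; [exact: cst_continuous|exact: poly_growth_cst].
by apply/funext => x; rewrite derive_cst.
Qed.

Lemma derive_coord i (x v : 'rV[R]_n) : 'D_v (fun y : 'rV[R]_n => y 0 i : R) x = v 0 i.
Proof.
rewrite /derive; apply: lim_near_cst => //; near=> h => /=.
rewrite !mxE addrK /GRing.scale/= mulrA mulVf ?mul1r//.
by near: h; exact: nbhs_dnbhs_neq.
Unshelve. all: by end_near. Qed.

Lemma tame_coord i : tame (fun y : 'rV[R]_n => y 0 i).
Proof.
split=> [x||v]; first exact: differentiable_coord.
  by apply: (@poly_growth_le _ _ _ 1) => // x; rewrite mul1r rV_coord_le_norm.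
rewrite (_ : 'D_v _ = cst (v 0 i)); first by split; [exact: cst_continuous|exact: poly_growth_cst].
by apply/funext => x; rewrite derive_coord.
Qed.

Lemma tameD f g : tame f -> tame g -> tame (f \+ g).
Proof.
move=> [df pf vf] [dg pg vg]; split=> [x||v].
- exact: differentiableD.
- exact: poly_growthD.
- have -> : 'D_v (f \+ g) = 'D_v f \+ 'D_v g.
    by apply/funext => x; rewrite (@deriveD _ _ _ f g)//; exact: diff_derivable.
  have [cf Pf] := vf v; have [cg Pg] := vg v.
  split; last exact: poly_growthD.
  exact: continuous_add.
Qed.

Lemma derive_mul f g x v : differentiable f x -> differentiable g x ->
  'D_v (f \* g) x = 'D_v f x * g x + f x * 'D_v g x.
Proof.
move=> df dg; rewrite (@deriveM _ _ f g); [|exact: diff_derivable..].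
by rewrite addrC /GRing.scale/= (mulrC (g x)).
Qed.

Lemma tameM f g : tame f -> tame g -> tame (f \* g).
Proof.
move=> Tf Tg; have [df pf vf] := Tf; have [dg pg vg] := Tg; split=> [x||v].
- exact: differentiableM.
- exact: poly_growthM.
- have -> : 'D_v (f \* g) = ('D_v f \* g) \+ (f \* 'D_v g).
    by apply/funext => x; rewrite derive_mul.
  have [cf Pf] := vf v; have [cg Pg] := vg v; split.
    by apply: continuous_add; apply: continuous_mul => //; exact: tame_continuous.
  by apply: poly_growthD; exact: poly_growthM.
Qed.

Lemma smooth_bounded_tame f : smooth_bounded f -> tame f.
Proof.
move=> sf; have [df [M fM]] := sf [::].
split=> // [|v]; first exact: poly_growth_bounded fM.
have -> : 'D_v f = \sum_i (cst (v 0 i) \* partial f i).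
  by apply/funext => x; rewrite derive_partial// fct_sumE.
have h i : continuous (partial f i) /\ poly_growth (partial f i).
  have [di [Mi fi]] := sf [:: i]; split; last exact: poly_growth_bounded fi.
  by move=> x; apply: differentiable_continuous; exact: di.
elim/big_ind : _ => [|u w [cu pu] [cw pw]|i _].
- by split; [exact: cst_continuous|exact: poly_growth_cst].
- by split; [exact: continuous_add|exact: poly_growthD].
- split; first by apply: continuous_mul; [exact: cst_continuous|exact: (h i).1].
  by apply: poly_growthM; [exact: poly_growth_cst|exact: (h i).2].
Qed.

End tame_theory.

(** The chain rule for a linear inner map already holds for difference quotients; the
    bound on $L$ makes polynomial growth pass to the composition. *)
Lemma tame_comp m n (L : {linear 'rV[R]_m -> 'rV[R]_n}) (f : 'rV[R]_n -> R) :
  continuous L -> (forall x, `|L x| <= `|x|) -> tame f ->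
  tame (f \o L) /\ forall v x, 'D_v (f \o L) x = 'D_(L v) f (L x).
Proof.
move=> cL L1 [df pf vf].
have E v x : 'D_v (f \o L) x = 'D_(L v) f (L x).
  rewrite /derive; set a := (X in lim (X @ _) = _).
  set b := (X in _ = lim (X @ _)); suff -> : a = b by [].
  apply/funext => h; rewrite /a/b/=.
  by have -> : L (h *: v + x) = h *: L v + L x by exact: linearP.
have PL g : poly_growth g -> poly_growth (g \o L).
  apply: (@poly_growth_comp _ _ _ _ _ 1) => // x.
  by rewrite mul1r (le_trans (L1 x))// lerDr.
split=> //; split=> [x||v].
- by apply: differentiable_comp => //; exact: linear_differentiable.
- exact: PL.
- rewrite (_ : 'D_v _ = 'D_(L v) f \o L); last by apply/funext => x; rewrite E.
  split; last by apply: PL; exact: (vf _).2.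
  by move=> x; apply: continuous_comp; [exact: cL|exact: (vf _).1].
Qed.

Lemma tame_lsubmx m n (f : 'rV[R]_m -> R) : tame f ->
  tame (fun y : 'rV[R]_(m + n) => f (lsubmx y)) /\
  forall v x, 'D_v (fun y : 'rV[R]_(m + n) => f (lsubmx y)) x = 'D_(lsubmx v) f (lsubmx x).
Proof.
apply: (@tame_comp _ _ lsubmx); first exact: continuous_lsubmx.
by move=> x; apply: rV_norm_le => // i; rewrite mxE rV_coord_le_norm.
Qed.

Lemma tame_rsubmx m n (f : 'rV[R]_n -> R) : tame f ->
  tame (fun y : 'rV[R]_(m + n) => f (rsubmx y)) /\
  forall v x, 'D_v (fun y : 'rV[R]_(m + n) => f (rsubmx y)) x = 'D_(rsubmx v) f (rsubmx x).
Proof.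
apply: (@tame_comp _ _ rsubmx); first exact: continuous_rsubmx.
by move=> x; apply: rV_norm_le => // i; rewrite mxE rV_coord_le_norm.
Qed.

End tame.

(** * Increments of the Wiener process on a partition *)

Section ae_transfer.
Context d {R : realType} (W : measurableType d) (P : probability W R).

Lemma ae_integral_eq (X Y : W -> R) :
  measurable_fun setT X -> measurable_fun setT Y ->
  (\forall w \ae P, X w = Y w) -> (\int[P]_w (X w)%:E = \int[P]_w (Y w)%:E)%E.
Proof.
move=> mX mY XY; apply: ae_eq_integral => //; try exact/measurable_EFinP.
by apply: filterS XY => w /= ->.
Qed.

Lemma ae_integrable (X Y : W -> R) :
  measurable_fun setT X -> (\forall w \ae P, X w = Y w) ->
  P.-integrable setT (EFin \o Y) -> P.-integrable setT (EFin \o X).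
Proof.
move=> mX XY /integrableP[/measurable_EFinP mY iY].
apply/integrableP; split; first exact/measurable_EFinP.
apply: le_lt_trans iY; rewrite le_eqVlt; apply/orP; left; apply/eqP.
apply: (@ae_integral_eq (fun w => `|X w|) (fun w => `|Y w|)).
- exact: measurableT_comp.
- exact: measurableT_comp.
- by apply: filterS XY => w /= ->.
Qed.

Lemma ae_all_moments (X Y : W -> R) :
  measurable_fun setT X -> (\forall w \ae P, X w = Y w) ->
  all_moments P Y -> all_moments P X.
Proof.
move=> mX XY [mY iY]; split=> // k.
apply: (@ae_integrable (fun w => `|X w| ^+ k) (fun w => `|Y w| ^+ k)).
- by apply/measurable_funX; exact: measurableT_comp.
- by apply: filterS XY => w /= ->.
- exact: iY.
Qed.

End ae_transfer.

Section wiener.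
Context {R : realType} {T : R}.
Variable P : probability (path_space T) R.
Hypothesis P_wiener : wiener_measure P.

Lemma path_out (w : path_space T) u : u \notin `[0, T] -> w u = 0.
Proof. by case: w => w /= /pathsP[_]; exact. Qed.

Lemma pathZ c (w : path_space T) u : (c *: w) u = c * w u.
Proof. by []. Qed.

Lemma measurable_eval (u : R) : measurable_fun setT (fun w : path_space T => w u).
Proof.
have [u0|u0] := boolP (u \in `[0, T]); last first.
  rewrite (_ : (fun _ => _) = cst 0); first exact: measurable_cst.
  by apply/funext => w; rewrite path_out.
move=> _ B mB; rewrite setTI; apply: sub_sigma_algebra.
by exists u => //; exists B.
Qed.

Lemma ae_start0 : \forall w \ae P, (w : path_space T) 0 = 0.
Proof.
have [P0 _ _] := P_wiener.
have m0 : measurable [set w : path_space T | w 0 = 0].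
  rewrite -[X in measurable X]setTI.
  by apply: (measurable_eval 0 measurableT (Y := [set 0])); exact: measurable_set1.
exists (~` [set w : path_space T | w 0 = 0]); split => //.
- exact: measurableC.
- by rewrite probability_setC// P0 subee.
Qed.

(** Partitions start at 0: the first increment is then the value of the path at
    $t_1$, almost surely. *)
Definition time_grid (t : nat -> R) (m : nat) :=
  [/\ t 0%N = 0, forall i, (i < m)%N -> t i < t i.+1 & t m <= T].

Definition increment (t : nat -> R) (i : nat) (w : path_space T) := w (t i.+1) - w (t i).

Section grid.
Variables (t : nat -> R) (m : nat).
Hypothesis tm : time_grid t m.

Lemma time_grid_le i j : (i <= j <= m)%N -> t i <= t j.
Proof.
have [_ tS _] := tm.
elim: j => [|j ih] /andP[]; first by rewrite leqn0 => /eqP ->.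
rewrite leq_eqVlt => /predU1P[-> //|ij jm].
by rewrite (le_trans (ih _))// ?(ltW (tS _ jm))// -ltnS ij ltnW.
Qed.

Lemma time_grid_ge0 i : (i <= m)%N -> 0 <= t i.
Proof. by have [t0 _ _] := tm; move=> im; rewrite -t0 time_grid_le. Qed.

Lemma time_grid_leT i : (i <= m)%N -> t i <= T.
Proof. by have [_ _ tT] := tm; move=> im; rewrite (le_trans _ tT)// time_grid_le// im /=. Qed.

Lemma measurable_increment i : measurable_fun setT (increment t i).
Proof. by apply: measurable_funB; exact: measurable_eval. Qed.

Lemma increment_law a B : (a < m)%N -> measurable B ->
  P (increment t a @^-1` B) = normal_prob 0 (Num.sqrt (t a.+1 - t a)) B.
Proof.
move=> am mB; have [_ inc _] := P_wiener; have [_ tS _] := tm.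
by apply: inc => //; [exact/time_grid_ge0/ltnW|exact: tS|exact: time_grid_leT].
Qed.

Lemma increments_indep (B : nat -> set R) : (forall i, measurable (B i)) ->
  P (\bigcap_(i < m) (increment t i @^-1` B i)) =
  (\prod_(i < m) P (increment t i @^-1` B i))%E.
Proof.
move=> mB; have [_ _ ind] := P_wiener; have [t0 tS tT] := tm.
by have := ind m t; rewrite t0; exact.
Qed.

Lemma all_moments_increment a : (a < m)%N -> all_moments P (increment t a).
Proof.
move=> am; have [_ tS _] := tm.
have s0 : 0 < Num.sqrt (t a.+1 - t a) by rewrite sqrtr_gt0 subr_gt0 tS.
split=> [|k]; first exact: measurable_increment.
have mX : measurable_fun setT (increment t a : path_space T -> measurableTypeR R).
  exact: measurable_increment.
pose X : {mfun path_space T >-> measurableTypeR R} :=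
  @mfun_Sub _ _ (path_space T) (measurableTypeR R) (increment t a) (mem_set mX).
have pk : poly_growth (fun x : R => `|x| ^+ k).
  exists 1, k => x; rewrite mul1r ger0_norm ?exprn_ge0// lerXn2r// ?nnegrE ?addr_ge0//.
  by rewrite lerDr.
have mk : measurable_fun setT (fun x : R => `|x| ^+ k).
  by apply: measurable_funX; exact: normr_measurable.
have /integrableP[_ ik] := poly_growth_integrable_normal s0 mk pk.
apply/integrableP; split.
  by apply/measurable_EFinP; apply: measurableT_comp mk (measurable_increment a).
apply: le_lt_trans ik.
have mEk : measurable_fun setT (fun x : R => `|(`|x| ^+ k)%:E|%E).
  by apply: measurableT_comp => //; exact/measurable_EFinP.
rewrite -(@ge0_integral_distribution _ _ _ _ _ P X _ mEk)//.
rewrite le_eqVlt; apply/orP; left; apply/eqP.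
apply: eq_measure_integral => A mA _; exact: increment_law.
Qed.

End grid.

Lemma all_moments_eval u : all_moments P (fun w : path_space T => w u).
Proof.
have [/andP[u0 uT]|nu] := boolP (0 <= u <= T); last first.
  rewrite (_ : (fun _ => _) = cst 0); first exact: all_moments_cst.
  by apply/funext => w; rewrite path_out.
have W0 : all_moments P (fun w : path_space T => w 0).
  apply: (@ae_all_moments _ _ _ _ _ (cst 0)); first exact: measurable_eval.
    exact: ae_start0.
  exact: all_moments_cst.
move: u0; rewrite le_eqVlt => /predU1P[<- //|u0].
pose t i := if i is 0%N then 0 else u.
have tg : time_grid t 1 by split=> // -[].
rewrite (_ : (fun w => _) = increment t 0 \+ (fun w => w 0)).
  exact: all_momentsD (all_moments_increment tg (ltn0Sn 0)) W0.
by apply/funext => w; rewrite /= /increment/= subrK.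
Qed.

Lemma all_moments_coords n (u : 'I_n -> R) (f : 'rV[R]_n -> R) :
  continuous f -> poly_growth f -> all_moments P (f \o coords u).
Proof.
move=> cf pf; apply: poly_growth_all_moments => // i.
by under eq_fun do rewrite mxE; exact: all_moments_eval.
Qed.

End wiener.

Section increments.
Context {R : realType} {T : R}.
Variable P : probability (path_space T) R.
Hypothesis P_wiener : wiener_measure P.
Variables (t : nat -> R) (m : nat).
Hypothesis tm : @time_grid R T t m.
Variable a : nat.
Hypothesis am : (a < m)%N.

Local Notation inc := (@increment R T t).
Local Notation tau := (t a.+1 - t a).

(** Finite intersections of constraints on the increments other than the $a$-th one:
    a pi-system generating the sigma-algebra of these increments. *)
Definition other_increments : set (set (path_space T)) :=
  [set A | exists2 B : nat -> set R, (forall i, measurable (B i)) &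
    A = \bigcap_(i in [set i | (i < m)%N /\ i != a]) (inc i @^-1` B i)].

Let Om := g_sigma_algebraType other_increments.

Let measurable_inc_preimage i B : measurable B -> measurable (inc i @^-1` B).
Proof. by move=> mB; rewrite -[X in measurable X]setTI; exact: measurable_increment. Qed.

Lemma other_increments_measurable : other_increments `<=` measurable.
Proof.
move=> _ [B mB ->]; apply: fin_bigcap_measurable => [|i _].
  by apply: (sub_finite_set _ (finite_II m)) => i [].
exact: measurable_inc_preimage.
Qed.

Lemma other_incrementsI : setI_closed other_increments.
Proof.
move=> _ _ [B mB ->] [C mC ->]; exists (fun i => B i `&` C i).
  by move=> i; exact: measurableI.
by rewrite -bigcapI; apply: eq_bigcapr.
Qed.

(** On the pi-system this is the product formula for all increments, used once with
    $A$ and once with the whole line as constraint on the $a$-th one. *)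
Let indep_generator A B : measurable A -> other_increments B ->
  P (inc a @^-1` A `&` B) = (normal_prob 0 (Num.sqrt tau) A * P B)%E.
Proof.
move=> mA [C mC ->].
pose D X i := if i == a then X else C i.
have mD X : measurable X -> forall i, measurable (D X i).
  by move=> mX i; rewrite /D; case: ifP.
have E X : measurable X -> P (inc a @^-1` X `&`
    \bigcap_(i in [set i | (i < m)%N /\ i != a]) (inc i @^-1` C i)) =
  (P (inc a @^-1` X) * \prod_(i < m | i != Ordinal am) P (inc i @^-1` C i))%E.
  move=> mX; have := increments_indep P_wiener tm (mD X mX).
  have DX : D X a = X by rewrite /D eqxx.
  rewrite (bigD1 (Ordinal am))//= DX.
  rewrite (eq_bigr (fun i : 'I_m => P (inc i @^-1` C i))); last first.
    by move=> i ia; rewrite /D ifF//; apply/negbTE.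
  move=> <-; congr (P _); apply/seteqP; split=> w.
    by move=> [Xw Cw] i /= im; rewrite /D; case: eqP => [->//|/eqP ia]; exact: Cw.
  move=> h; split; first by have := h a am; rewrite DX.
  by move=> i [im ia]; have := h i im; rewrite /D (negbTE ia).
rewrite E// (increment_law P_wiener tm am mA); congr (_ * _)%E.
by have := E setT measurableT; rewrite preimage_setT setTI probability_setT mul1e.
Qed.

(** Two finite measures that agree on a pi-system agree on the generated
    sigma-algebra. *)
Lemma increment_indep A B : measurable A -> <<s other_increments>> B ->
  P (inc a @^-1` A `&` B) = (normal_prob 0 (Num.sqrt tau) A * P B)%E.
Proof.
move=> mA sB.
have [r NA] : exists r : {nonneg R}, (normal_prob 0 (Num.sqrt tau) A = r%:num%:E)%E.
  have NA0 : 0 <= fine (normal_prob 0 (Num.sqrt tau) A) by exact: fine_ge0.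
  by exists (NngNum NA0); rewrite /= fineK// fin_num_measure.
pose m1 := mrestr P (measurable_inc_preimage a mA).
pose m2 := mscale r P.
suff : m1 B = m2 B by rewrite /m1 /m2 /mrestr /mscale NA setIC.
apply: (g_sigma_algebra_measure_unique other_increments _ (fun=> setT)) sB.
- exact: other_increments_measurable.
- by move=> _; exists (fun=> setT) => //; rewrite bigcapT.
- by rewrite bigcup_const//; exists 0%N.
- exact: other_incrementsI.
- move=> C hC; change (P (C `&` inc a @^-1` A) = r%:num%:E * P C)%E.
  by rewrite setIC -NA; exact: indep_generator.
- move=> _; rewrite /m1 /mrestr (le_lt_trans (probability_le1 _ _)) ?ltry//.
  by rewrite setTI; exact: measurable_inc_preimage.
Qed.

Lemma measurable_other_increment i : (i < m)%N -> i != a ->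
  measurable_fun (setT : set Om) (inc i : Om -> R).
Proof.
move=> im ia _ B mB; rewrite setTI; apply: sub_sigma_algebra.
exists (fun j => if j == i then B else setT) => [j|]; first by case: ifP.
apply/seteqP; split=> [w Bw j [jm ja]|w h].
  by rewrite /=; case: eqP => [->|].
by have := h i (conj im ia); rewrite eqxx.
Qed.

Lemma measurable_id_other : measurable_fun setT (id : path_space T -> Om).
Proof.
move=> _ B mB; rewrite setTI preimage_id.
move: B mB; apply: smallest_sub; last exact: other_increments_measurable.
exact: sigma_algebra_measurable.
Qed.

End increments.

(** * Integration by parts along the paths min(r, .) *)

Lemma sum_ord_except (V : zmodType) (F : nat -> V) (a j : nat) :
  \sum_(b < j) F b = \sum_(b < j | b != a :> nat) F b + (if (a < j)%N then F a else 0).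
Proof.
case: ifPn => [aj|]; first by rewrite (bigD1 (Ordinal aj))//= addrC.
rewrite -leqNgt addr0 => ja; rewrite [RHS]big_mkcond/=; apply: eq_bigr => b _.
by rewrite ifT// ltn_eqF// (leq_trans (ltn_ord b)).
Qed.

Lemma measurable_sum_filter d (W : measurableType d) (R : realType) I (r : seq I)
    (Q : pred I) (X : I -> W -> R) :
  (forall i, Q i -> measurable_fun setT (X i)) ->
  measurable_fun setT (fun w => \sum_(i <- r | Q i) X i w).
Proof.
move=> mX; rewrite (_ : (fun _ => _) = \sum_(i <- r | Q i) X i); last first.
  by apply/funext => w; rewrite fct_sumE.
elim/big_ind : _ => [|? ? ? ?|]; last exact: mX.
  exact: (@measurable_cst _ _ W R setT 0).
exact: measurable_funD.
Qed.

Section increment_ibp.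
Context {R : realType} {T : R}.
Variable P : probability (path_space T) R.
Hypothesis P_wiener : wiener_measure P.
Variables (t : nat -> R) (m : nat).
Hypothesis tm : @time_grid R T t m.
Variables (k : nat) (kappa : 'I_k -> nat).
Hypothesis kappa_le : forall i, (kappa i <= m)%N.
Variable phi : 'rV[R]_k -> R.
Hypothesis tphi : tame phi.

Local Notation inc := (@increment R T t).
Let u i := t (kappa i).

Lemma sum_increments j (w : path_space T) :
  \sum_(b < j) inc b w = w (t j) - w 0.
Proof.
have [t0 _ _] := tm.
rewrite -[in RHS]t0 -(telescope_sumr (fun b => w (t b)))// big_mkord.
by apply: eq_bigr.
Qed.

(** Almost surely $W_u = Y + \xi v$, where $\xi$ is the $a$-th increment, $v$ flags the
    times after it, and $Y$ is a sum of other increments.  Given $Y$, this is Gaussian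
    integration by parts for $x \mapsto \phi(Y + x v)$. *)
Lemma increment_ibp a : (a < m)%N ->
  let v : 'rV[R]_k := \row_i (a < kappa i)%:R in
  (\int[P]_w ((t a.+1 - t a) * 'D_v phi (coords u w))%:E =
   \int[P]_w (increment t a w * phi (coords u w))%:E)%E.
Proof.
move=> am v; have [_ tS _] := tm.
set tau := t a.+1 - t a; have tau0 : 0 < tau by rewrite subr_gt0 tS.
pose s := Num.sqrt tau; have s0 : 0 < s by rewrite sqrtr_gt0.
have s2 : s ^+ 2 = tau by rewrite sqr_sqrtr// ltW.
pose Om := g_sigma_algebraType (@other_increments R T t m a).
(* Y is measurable for the sigma-algebra of the other increments only. *)
pose Y (z : Om) : 'rV[R]_k := \row_i \sum_(b < kappa i | b != a :> nat) inc b z.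
pose line (xz : measurableTypeR R * Om) := Y xz.2 + (xz.1 : R) *: v.
pose f1 (xz : measurableTypeR R * Om) := tau * 'D_v phi (line xz).
pose f2 (xz : measurableTypeR R * Om) := xz.1 * phi (line xz).
have cphi := tame_continuous tphi.
have [dphi pphi /(_ v)[cphi' pphi']] := tphi.
have mline i : measurable_fun setT (fun xz => line xz 0 i).
  rewrite (_ : (fun _ => _) = fun xz : measurableTypeR R * Om =>
    \sum_(b < kappa i | b != a :> nat) inc b xz.2 + (xz.1 : R) * v 0 i); last first.
    by apply/funext => xz; rewrite /line /Y !mxE.
  apply: measurable_funD; last by apply: measurable_funM => //; exact: measurable_fst.
  apply: measurable_sum_filter => b ba.
  have bm : (b < m)%N by rewrite (leq_trans (ltn_ord b)).
  exact: measurableT_comp (measurable_other_increment bm ba) measurable_snd.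
have mfline (f : 'rV[R]_k -> R) : continuous f -> measurable_fun setT (fun xz => f (line xz)).
  exact: (@continuous_rV_measurable _ _ _ _ line mline).
have mf1 : measurable_fun setT f1.
  by apply: measurable_funM => //; exact: (mfline ('D_v phi)).
have mf2 : measurable_fun setT f2.
  by apply: measurable_funM; [exact: measurable_fst|exact: (mfline phi)].
have minc := @measurable_increment R T t a.
have mcoords (f : 'rV[R]_k -> R) : continuous f -> measurable_fun setT (f \o @coords R T k u).
  move=> cf; apply: (@continuous_rV_measurable _ _ _ _ (@coords R T k u)) => // i.
  by under eq_fun do rewrite mxE; exact: measurable_eval.
have line_ae : \forall w \ae P, coords u w = line (inc a w, w).
  apply: filterS (ae_start0 P_wiener) => w w0; apply/rowP => i.
  rewrite /line /Y !mxE; have := sum_increments (kappa i) w.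
  rewrite w0 subr0 => <-; rewrite (sum_ord_except (fun b => inc b w) a (kappa i)); congr (_ + _).
  by case: ifP => _; rewrite ?mulr1 ?mulr0.
have mline' (f : 'rV[R]_k -> R) : continuous f ->
    measurable_fun setT (fun w : path_space T => f (line (inc a w, w))).
  move=> cf; apply: (@measurableT_comp _ _ _ _ _ _ (fun xz => f (line xz)) _
    (fun w : path_space T => (inc a w, w : Om))).
    exact: (mfline f).
  by apply: measurable_fun_pair => //; exact: measurable_id_other.
transitivity (\int[P]_w (f1 (inc a w, w))%:E)%E.
  apply: ae_integral_eq.
  - by apply: measurable_funM => //; exact: (mcoords ('D_v phi)).
  - by apply: measurable_funM => //; exact: (mline' ('D_v phi)).
  - by apply: filterS line_ae => w E; rewrite /f1 -E.
transitivity (\int[P]_w (f2 (inc a w, w))%:E)%E; last first.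
  apply: ae_integral_eq.
  - by apply: measurable_funM => //; exact: (mline' phi).
  - by apply: measurable_funM => //; exact: (mcoords phi).
  - by apply: filterS line_ae => w E; rewrite /f2 -E.
apply: (@indep_eq_integral _ _ _ _ _ (measurableTypeR R) Om P (normal_prob 0 s) (inc a) id) => //.
- exact: measurable_id_other.
- by move=> A B mA mB; exact: (increment_indep P_wiener tm am).
- apply: (@ae_integrable _ _ _ _ _ (fun w => tau * 'D_v phi (coords u w))).
  + by apply: measurable_funM => //; exact: (mline' ('D_v phi)).
  + by apply: filterS line_ae => w E; rewrite /f1 -E.
  + apply: all_moments_integrable; apply: all_momentsM; first exact: all_moments_cst.
    exact: (all_moments_coords P_wiener u cphi' pphi').
- apply: (@ae_integrable _ _ _ _ _ (fun w => inc a w * phi (coords u w))).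
  + by apply: measurable_funM => //; exact: (mline' phi).
  + by apply: filterS line_ae => w E; rewrite /f2 -E.
  + apply: all_moments_integrable; apply: all_momentsM.
      exact: (all_moments_increment P_wiener tm am).
    exact: (all_moments_coords P_wiener u cphi pphi).
- move=> z; pose psi x := phi (Y z + x *: v).
  have psi' : derive1 psi = fun x => 'D_v phi (Y z + x *: v).
    by apply/funext => x; rewrite derive1E derive_line.
  have cl : continuous (fun x : R => Y z + x *: v).
    move=> x; apply: cvgD; first exact: cvg_cst.
    by apply: cvgZr_tmp; exact: cvg_id.
  have PL (f : 'rV[R]_k -> R) : poly_growth f -> poly_growth (fun x : R => f (Y z + x *: v)).
    apply: (@poly_growth_comp _ _ _ _ _ (`|Y z| + `|v|)); first exact: addr_ge0.
    move=> x; rewrite (le_trans (ler_normD _ _))// normrZ mulrDr mulr1 lerD ?lerDl//.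
    by rewrite mulrC ler_wpM2r// lerDr.
  have dpsi x : derivable psi x 1 by exact: derivable_line.
  have cpsi' : continuous (derive1 psi).
    by rewrite psi' => x; exact: (@continuous_comp _ _ _ _ ('D_v phi) x (cl x) (cphi' _)).
  have := @gaussian_stein R s s0 psi dpsi cpsi' (PL _ pphi).
  rewrite psi' s2 => /(_ (PL _ pphi')) St.
  have mline1 (f : 'rV[R]_k -> R) : continuous f ->
      measurable_fun setT (fun x : measurableTypeR R => f (Y z + (x : R) *: v)).
    move=> cf; apply: continuous_measurable_fun => x.
    exact: (@continuous_comp _ _ _ _ f x (cl x) (cf _)).
  have i1 := poly_growth_integrable_normal s0 (mline1 _ cphi') (PL _ pphi').
  have idpg : poly_growth (fun x : R => x / tau).
    apply: (@poly_growth_le _ _ _ tau^-1) => [|x]; first by rewrite invr_ge0 ltW.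
    by rewrite mulrC normrM ger0_norm// invr_ge0 ltW.
  have i2 : (normal_prob 0 s).-integrable setT
      (EFin \o (fun x : measurableTypeR R => (x : R) / tau * psi x)).
    apply: poly_growth_integrable_normal => //.
      by apply: measurable_funM; [exact: measurable_funM|exact: mline1].
    by apply: poly_growthM => //; exact: PL.
  transitivity (tau%:E * \int[normal_prob 0 s]_x ('D_v phi (Y z + (x : R) *: v))%:E)%E.
    by rewrite -integralZl//.
  rewrite St -integralZl//; apply: eq_integral => x _.
  by rewrite /f2 /line /= -EFinM mulrA mulrCA divff ?mulr1// gt_eqF.
Qed.

End increment_ibp.

Section ibp.
Context {R : realType} {T : R}.
Variable P : probability (path_space T) R.
Hypothesis P_wiener : wiener_measure P.

Lemma integral_sum_moments I (r : seq I) (X : I -> path_space T -> R) :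
  (forall i, all_moments P (X i)) ->
  (\int[P]_w (\sum_(i <- r) X i w)%:E = \sum_(i <- r) \int[P]_w (X i w)%:E)%E.
Proof.
move=> hX; under eq_integral do rewrite -sumEFin.
by rewrite integral_sum// => i; exact: all_moments_integrable.
Qed.

Lemma telescope_minn (F : nat -> R) i j :
  \sum_(a < i | (a < j)%N) (F a.+1 - F a) = F (minn i j) - F 0%N.
Proof.
elim: i => [|i ih]; first by rewrite big_ord0 min0n subrr.
rewrite big_mkcond big_ord_recr -big_mkcond/= ih.
case: ifPn => [ij|]; last rewrite -leqNgt => ji.
  by rewrite (minn_idPl (ltnW ij)) (minn_idPl ij); ring.
by rewrite addr0 (minn_idPr ji) (minn_idPr (leqW ji)).
Qed.

Lemma time_grid_of_seq (l : seq R) : {in l, forall r, 0 <= r <= T} -> 0 <= T ->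
  exists t m, @time_grid R T t m /\ {in l, forall r, exists2 i, (i <= m)%N & t i = r}.
Proof.
move=> l0T T0; pose s := sort <=%R (undup (0 :: l)).
have sP r : (r \in s) = (r == 0) || (r \in l) by rewrite mem_sort mem_undup inE.
have s_sorted : sorted <%R s.
  by rewrite lt_sorted_uniq_le sort_uniq undup_uniq sort_sorted//; exact: le_total.
have s_size : (0 < size s)%N.
  by have : 0 \in s; [rewrite sP eqxx|case: (s)].
have sin r : r \in s -> 0 <= r <= T.
  by rewrite sP => /predU1P[->|/l0T//]; rewrite lexx.
exists (nth 0 s), (size s).-1; split.
  split.
  - have : 0 \in s by rewrite sP eqxx.
    case: s sin s_sorted {sP s_size} => // x s sin; rewrite /= lt_path_sortedE.
    rewrite inE => /andP[/allP xs _] /predU1P[//|/xs x0].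
    by have := sin x (mem_head _ _); rewrite leNgt x0.
  - move=> i; rewrite -ltnS (prednK s_size) => im.
    by have := (sortedP 0 s_sorted); apply.
  - by have /andP[] : 0 <= nth 0 s (size s).-1 <= T; [apply/sin/mem_nth; rewrite prednK|].
move=> r rl; have rs : r \in s by rewrite sP rl orbT.
exists (index r s); last exact: nth_index.
by rewrite -ltnS prednK// index_mem.
Qed.

Lemma min_path_itv (r x : R) : 0 <= x <= T -> min_path T r x = Num.min r x.
Proof. by move=> x0T; rewrite /= patchE ifT//; apply/mem_set; rewrite /= in_itv. Qed.

Section fixed_functional.
Variables (k : nat) (u : 'I_k -> R) (phi : 'rV[R]_k -> R).
Hypothesis u0T : forall i, 0 <= u i <= T.
Hypothesis tphi : tame phi.

Let Dphi_moments v : all_moments P (fun w => 'D_v phi (coords u w)).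
Proof.
by have [_ _ /(_ v)[cD pD]] := tphi; exact: (all_moments_coords P_wiener u cD pD).
Qed.

Let phi_moments : all_moments P (fun w => phi (coords u w)).
Proof.
have [_ pp _] := tphi.
exact: (all_moments_coords P_wiener u (tame_continuous tphi) pp).
Qed.

(** On a partition $(t_a)$ containing $r$ and the $u_i$, the path $r \wedge \cdot$
    restricted to the $u_i$ is the sum over $t_{a+1} \le r$ of $t_{a+1} - t_a$ times the
    shift of the $a$-th increment, while the increments before $r$ add up to $W_r$. *)
Lemma ibp_min_path r : 0 <= r <= T ->
  (\int[P]_w ('D_(coords u (min_path T r)) phi (coords u w))%:E =
   \int[P]_w (w r * phi (coords u w))%:E)%E.
Proof.
move=> r0T; have T0 : 0 <= T by case/andP: r0T => /le_trans; exact.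
have [|//|t [m [tm tP]]] := @time_grid_of_seq (r :: [seq u i | i <- enum 'I_k]).
  by move=> x; rewrite inE => /predU1P[->//|/mapP[i _ ->]].
have [rho rho_m rhoE] : exists2 i, (i <= m)%N & t i = r by apply: tP; exact: mem_head.
have tPu i : exists j, (j <= m)%N /\ t j = u i.
  have [j jm ju] : exists2 j, (j <= m)%N & t j = u i.
    by apply: tP; rewrite inE map_f ?orbT// mem_enum.
  by exists j.
pose kappa i := sval (cid (tPu i)).
have kappa_m i : (kappa i <= m)%N by rewrite /kappa; case: cid => j [].
have kappaE : u = (fun i => t (kappa i)).
  by apply/funext => i; rewrite /kappa; case: cid => j [].
pose v (a : nat) : 'rV[R]_k := \row_i (a < kappa i)%:R.
pose tau a := t a.+1 - t a.
have [t0 tS tT] := tm; have [dphi _ _] := tphi.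
have coordsE : coords u (min_path T r) = \sum_(a < rho) tau a *: v a.
  apply/rowP => i; rewrite mxE summxE min_path_itv//.
  transitivity (\sum_(a < rho | (a < kappa i)%N) tau a).
    rewrite telescope_minn t0 subr0 (congr1 (fun f => f i) kappaE) -rhoE.
    case: leqP => ij; first by rewrite min_l// (time_grid_le tm)// ij kappa_m.
    by rewrite min_r// (time_grid_le tm)// (ltnW ij) rho_m.
  rewrite big_mkcond; apply: eq_bigr => a _; rewrite !mxE.
  by case: ifP; rewrite ?mulr1 ?mulr0.
transitivity (\int[P]_w (\sum_(a < rho) tau a * 'D_(v a) phi (coords u w))%:E)%E.
  apply: eq_integral => w _; rewrite coordsE derive_sum//; congr (_%:E).
  by apply: eq_bigr => a _; rewrite derive_scale.
rewrite integral_sum_moments; last first.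
  by move=> a; apply: all_momentsM; [exact: all_moments_cst|exact: Dphi_moments].
transitivity (\int[P]_w (\sum_(a < rho) increment t a w * phi (coords u w))%:E)%E.
  rewrite integral_sum_moments; last first.
    move=> a; apply: all_momentsM => //.
    exact: (all_moments_increment P_wiener tm (leq_trans (ltn_ord a) rho_m)).
  apply: eq_bigr => a _; rewrite kappaE.
  exact: (increment_ibp P_wiener tm kappa_m tphi (leq_trans (ltn_ord a) rho_m)).
apply: ae_integral_eq.
- apply: measurable_sum_filter => a _; apply: measurable_funM.
    exact: measurable_increment.
  by case: phi_moments.
- by apply: measurable_funM; [exact: measurable_eval|case: phi_moments].
- apply: filterS (ae_start0 P_wiener) => w w0.
  by rewrite -mulr_suml (sum_increments tm) w0 subr0 rhoE.
Qed.

Lemma path_sumE I (l : seq I) (F : I -> path_space T) x :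
  (\sum_(i <- l) F i) x = \sum_(i <- l) F i x.
Proof. by elim/big_ind2 : _ => // ? ? ? ? <- <-. Qed.

Lemma coords_span n (v : 'I_n -> R) p (c r : 'I_p -> R) :
  coords v (\sum_j c j *: min_path T (r j)) = \sum_j c j *: coords v (min_path T (r j)).
Proof.
apply/rowP => i; rewrite mxE path_sumE summxE.
by apply: eq_bigr => j _; rewrite !mxE.
Qed.

Lemma ibp_span p (c r : 'I_p -> R) : (forall j, 0 <= r j <= T) ->
  (\int[P]_w ('D_(coords u (\sum_j c j *: min_path T (r j))) phi (coords u w))%:E =
   \int[P]_w ((\sum_j c j * w (r j)) * phi (coords u w))%:E)%E.
Proof.
move=> r0T; have [dphi _ _] := tphi.
transitivity (\int[P]_w (\sum_j c j * 'D_(coords u (min_path T (r j))) phi (coords u w))%:E)%E.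
  apply: eq_integral => w _; rewrite coords_span derive_sum//; congr (_%:E).
  by apply: eq_bigr => a _; rewrite derive_scale.
under [RHS]eq_integral do rewrite mulr_suml.
rewrite integral_sum_moments; last first.
  by move=> j; apply: all_momentsM; [exact: all_moments_cst|exact: Dphi_moments].
rewrite integral_sum_moments; last first.
  move=> j; apply: all_momentsM => //; apply: all_momentsM; first exact: all_moments_cst.
  exact: all_moments_eval.
apply: eq_bigr => j _.
under eq_integral do rewrite EFinM.
under [RHS]eq_integral do rewrite -mulrA EFinM.
rewrite integralZl//; last exact: (all_moments_integrable (Dphi_moments _)).
rewrite integralZl//; last first.
  exact: (all_moments_integrable (all_momentsM (all_moments_eval P_wiener (r j)) phi_moments)).
by rewrite ibp_min_path.
Qed.

End fixed_functional.

(** The product $f(W_u) g(W_s)$ is one function of the concatenated times; the product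
    rule then moves the derivative from $f$ to $g$. *)
Lemma ibp_product k n (u : 'I_k -> R) (s : 'I_n -> R) f g p (c r : 'I_p -> R) :
  (forall i, 0 <= u i <= T) -> (forall i, 0 <= s i <= T) -> (forall j, 0 <= r j <= T) ->
  tame f -> tame g ->
  let h := \sum_j c j *: min_path T (r j) in
  (\int[P]_w (g (coords s w) * 'D_(coords u h) f (coords u w))%:E =
   \int[P]_w (f (coords u w) *
     (g (coords s w) * (\sum_j c j * w (r j)) - 'D_(coords s h) g (coords s w)))%:E)%E.
Proof.
move=> u0T s0T r0T tf tg h.
(* Concatenation of the times u and s. *)
pose us (i : 'I_(k + n)) := match fintype.split i with inl j => u j | inr j => s j end.
have lus w : lsubmx (coords us w : 'rV_(k + n)) = coords u w.
  by apply/rowP => i; rewrite !mxE /us; case: fintype.splitP => j /= ij;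
     [congr (w (u _)); exact: val_inj|have := ltn_ord i; rewrite ij ltnNge leq_addr].
have rus w : rsubmx (coords us w : 'rV_(k + n)) = coords s w.
  apply/rowP => i; rewrite !mxE /us; case: fintype.splitP => j /= ij.
    by have := ltn_ord j; rewrite -ij ltnNge leq_addr.
  by congr (w (s _)); apply: val_inj; move/addnI : ij.
have us0T i : 0 <= us i <= T by rewrite /us; case: fintype.split.
have [tf' Df] := tame_lsubmx n tf; have [tg' Dg] := tame_rsubmx k tg.
have tfg := tameM tf' tg'.
have := ibp_span us0T tfg c r0T; rewrite -/h.
have [df' _ _] := tf'; have [dg' _ _] := tg'.
under eq_integral do rewrite derive_mul// Df Dg !lus !rus.
under [X in _ = X -> _]eq_integral do rewrite /= lus rus.
have [_ pf /(_ (coords u h))[cDf pDf]] := tf; have [_ pg /(_ (coords s h))[cDg pDg]] := tg.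
have cf := tame_continuous tf; have cg := tame_continuous tg.
have Mf : all_moments P (fun w => f (coords u w)) by exact: (all_moments_coords P_wiener u cf pf).
have Mg : all_moments P (fun w => g (coords s w)) by exact: (all_moments_coords P_wiener s cg pg).
have MDf : all_moments P (fun w => 'D_(coords u h) f (coords u w)).
  exact: (all_moments_coords P_wiener u cDf pDf).
have MDg : all_moments P (fun w => 'D_(coords s h) g (coords s w)).
  exact: (all_moments_coords P_wiener s cDg pDg).
have Mr : all_moments P (fun w : path_space T => \sum_j c j * w (r j)).
  apply: all_moments_sum => j; apply: all_momentsM; first exact: all_moments_cst.
  exact: all_moments_eval.
have iA := all_moments_integrable (all_momentsM MDf Mg).
have iB := all_moments_integrable (all_momentsM Mf MDg).
have iC := all_moments_integrable (all_momentsM Mr (all_momentsM Mf Mg)).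
under eq_integral do rewrite EFinD.
rewrite integralD// => E.
transitivity (\int[P]_w ('D_(coords u h) f (coords u w) * g (coords s w))%:E)%E.
  by apply: eq_integral => w _; rewrite mulrC.
transitivity (\int[P]_w (((\sum_j c j * w (r j)) * (f (coords u w) * g (coords s w)))%:E -
    (f (coords u w) * 'D_(coords s h) g (coords s w))%:E))%E; last first.
  by apply: eq_integral => w _; rewrite -EFinB; congr (_%:E); ring.
rewrite integralB// -E addeK//.
exact: (integrable_fin_num measurableT iB).
Qed.

End ibp.

(** * Algebras stable under partial derivatives *)

Section generated_algebra.
Context {R : realType} {n m : nat}.
Variable F : 'I_m -> 'rV[R]_n -> R.

(** If the partial derivatives of the generators stay in the algebra then so do all
    iterated partial derivatives.  This handles at once the polynomials (generated by
    the coordinates) and the bounded smooth test functions (generated by logistic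
    functions of the coordinates, as $l' = l^2 - l$). *)
Inductive generated_algebra : ('rV[R]_n -> R) -> Prop :=
| generated_cst c : generated_algebra (cst c)
| generated_gen i : generated_algebra (F i)
| generated_add f g : generated_algebra f -> generated_algebra g -> generated_algebra (f \+ g)
| generated_mul f g : generated_algebra f -> generated_algebra g -> generated_algebra (f \* g).

Lemma generated_prod (r : seq 'I_m) :
  generated_algebra (fun y => \prod_(i <- r) F i y).
Proof.
elim: r => [|i r ih].
  by under eq_fun do rewrite big_nil; exact: generated_cst.
by under eq_fun do rewrite big_cons; apply: generated_mul => //; exact: generated_gen.
Qed.

Lemma generated_sum I (r : seq I) (Q : pred I) f :
  (forall i, generated_algebra (f i)) ->
  generated_algebra (fun y => \sum_(i <- r | Q i) f i y).
Proof.
move=> Ff; elim: r => [|i r ih].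
  by under eq_fun do rewrite big_nil; exact: generated_cst.
case: (boolP (Q i)) => Qi.
  under eq_fun do rewrite big_cons Qi.
  exact: generated_add.
by under eq_fun do rewrite big_cons (negbTE Qi).
Qed.

Hypothesis dF : forall i x, differentiable (F i) x.
Hypothesis partialF : forall i j, generated_algebra (partial (F i) j).

Lemma generated_algebra_partial f : generated_algebra f ->
  (forall x, differentiable f x) /\ forall j, generated_algebra (partial f j).
Proof.
elim=> {f} [c|i|f g _ [df pf] _ [dg pg]|f g Gf [df pf] Gg [dg pg]]; split=> //.
- move=> j; rewrite (_ : partial _ j = cst 0); first exact: generated_cst.
  by apply/funext => x; rewrite /partial derive_cst.
- by move=> x; exact: differentiableD.
- move=> j; rewrite (_ : partial _ j = partial f j \+ partial g j).
    exact: generated_add.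
  by apply/funext => x; rewrite /partial (@deriveD _ _ _ f g)//; exact: diff_derivable.
- by move=> x; exact: differentiableM.
- move=> j; rewrite (_ : partial _ j = (partial f j \* g) \+ (f \* partial g j)).
    by apply: generated_add; exact: generated_mul.
  by apply/funext => x; rewrite /partial derive_mul.
Qed.

Lemma generated_algebra_partials l f :
  generated_algebra f -> generated_algebra (partials f l).
Proof.
elim: l f => //= j l ih f Gf; apply: ih.
by have [_] := generated_algebra_partial Gf.
Qed.

Lemma generated_algebra_smooth_bounded f :
  (forall i, exists M, forall x, `|F i x| <= M) ->
  generated_algebra f -> smooth_bounded f.
Proof.
move=> bF Gf l; have Gl := generated_algebra_partials l Gf.
split; first by have [] := generated_algebra_partial Gl.
elim: Gl => [c|i|f1 g _ [A fA] _ [B gB]|f1 g _ [A fA] _ [B gB]].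
- by exists `|c|.
- exact: bF.
- exists (A + B) => x; exact: le_trans (ler_normD _ _) (lerD (fA x) (gB x)).
- exists (A * B) => x; rewrite normrM; exact: ler_pM.
Qed.

End generated_algebra.

Section polynomial.
Context {R : realType} {n : nat}.

Definition coordinate (i : 'I_n) (y : 'rV[R]_n) : R := y 0 i.

Lemma polynomial_coordinate_partial i j :
  generated_algebra coordinate (partial (coordinate i) j).
Proof.
rewrite (_ : partial _ _ = cst ((delta_mx 0 j : 'rV[R]_n) 0 i)); first exact: generated_cst.
by apply/funext => y; rewrite /partial derive_coord.
Qed.

Lemma differentiable_polynomial f y : generated_algebra coordinate f -> differentiable f y.
Proof.
move=> Gf; have dF i x : differentiable (coordinate i) x by exact: differentiable_coord.
by have [df _] := generated_algebra_partial dF polynomial_coordinate_partial Gf.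
Qed.

Lemma polynomial_tame f : generated_algebra coordinate f -> tame f.
Proof.
elim=> [c|i|f1 f2 _ t1 _ t2|f1 f2 _ t1 _ t2].
- exact: tame_cst.
- exact: tame_coord.
- exact: tameD.
- exact: tameM.
Qed.

End polynomial.

(** * Density of smooth cylindrical functionals *)

Section logistic.
Context {R : realType}.

Definition logistic (z : R) : R := (1 + expR z)^-1.

Lemma logistic_itv z : 0 <= logistic z <= 1.
Proof.
have e0 := expR_gt0 z.
by rewrite /logistic invr_ge0 invf_le1 ?addr_gt0// ?lerDl ?ltW// addr_gt0.
Qed.

Lemma is_derive_logistic (z : R) :
  is_derive z (1 : R) logistic (logistic z ^+ 2 - logistic z).
Proof.
have ne : 1 + expR z != 0 by rewrite gt_eqF// addr_gt0 ?expR_gt0.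
rewrite /logistic; apply: is_derive_eq => //.
rewrite /GRing.scale/= add0r; field.
exact: ne.
Qed.

Lemma logistic_Ny (z N : R) : 0 <= N -> z <= - N -> 1 - (1 + N)^-1 <= logistic z.
Proof.
move=> N0 zN; rewrite /logistic.
have e0 := expR_gt0 z.
have : expR z <= (1 + N)^-1.
  rewrite -[expR z]invrK -expRN lef_pV2 ?posrE ?expR_gt0 ?ltr_pwDl//.
  by apply: le_trans (expR_ge1Dx _); rewrite lerD2l lerNr.
set e := expR z in e0 *; move=> h.
apply: le_trans (_ : 1 - e <= _); first by rewrite lerD2l lerN2.
rewrite -[leRHS]mul1r ler_pdivlMr ?addr_gt0//; nra.
Qed.

Lemma logistic_y (z N : R) : 0 <= N -> N <= z -> logistic z <= (1 + N)^-1.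
Proof.
move=> N0 zN; rewrite /logistic lef_pV2 ?posrE ?ltr_pwDl ?expR_ge0// lerD2l.
by apply: le_trans zN _; apply: le_trans (expR_ge1Dx _); rewrite lerDr.
Qed.

(** The shift by $-N$ and the slope $N^2$ make the argument at most $-N$ for all
    $x \le b$, including $x = b$, and at least $N$ eventually for $x > b$. *)
Lemma logistic_cvg (b x : R) :
  logistic (n%:R * (n%:R * (x - b) - 1)) @[n --> \oo] --> ((x <= b)%R%:R : R).
Proof.
have h0 : (1 + n%:R)^-1 @[n --> \oo] --> (0 : R).
  rewrite [X in X @ _](_ : _ = @harmonic R); first exact: cvg_harmonic.
  by apply/funext => n; rewrite /= nat1r.
case: leP => xb; rewrite ?mulr1n ?mulr0n.
  have h1 : (1 - (1 + n%:R)^-1 : R) @[n --> \oo] --> (1 : R).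
    by rewrite -[X in _ --> X]subr0; apply: cvgB => //; exact: cvg_cst.
  apply: (squeeze_cvgr _ h1 (cvg_cst (1 : R))); apply: nearW => n.
  have /andP[_ ->] := logistic_itv (n%:R * (n%:R * (x - b) - 1)).
  rewrite andbT logistic_Ny// -[leRHS]mulrN1 ler_wpM2l//.
  by rewrite gerDr mulr_ge0_le0// subr_le0.
apply: (squeeze_cvgr _ (cvg_cst (0 : R)) h0); near=> n.
have /andP[-> _] := logistic_itv (n%:R * (n%:R * (x - b) - 1)).
rewrite logistic_y// -[leLHS]mulr1 ler_wpM2l// lerBrDr.
rewrite -ler_pdivrMr ?subr_gt0//; near: n; exact: nbhs_infty_ger.
Unshelve. all: by end_near. Qed.

Variables (m : nat) (alpha : R) (beta : 'I_m -> R).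

Definition logistic_coord (i : 'I_m) (y : 'rV[R]_m) : R :=
  logistic (alpha * (alpha * (y 0 i - beta i) - 1)).

Lemma is_derive_logistic_affine i (z : R) :
  is_derive z (1 : R) (fun z : R => logistic (alpha * (alpha * (z - beta i) - 1)))
    (let l := logistic (alpha * (alpha * (z - beta i) - 1)) in alpha ^+ 2 * (l ^+ 2 - l)).
Proof.
pose g (z : R) := alpha * (alpha * (z - beta i) - 1).
have dg : is_derive z (1 : R) g (alpha ^+ 2).
  by apply: is_derive_eq; rewrite /GRing.scale/=; ring.
have dl := is_derive_logistic (g z).
by have := @is_derive1_comp _ logistic g z _ _ dl dg; rewrite mulrC.
Qed.

Lemma differentiable_logistic_coord i x : differentiable (logistic_coord i) x.
Proof.
apply: (@differentiable_comp _ _ _ _ _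
  (fun z : R => logistic (alpha * (alpha * (z - beta i) - 1)))).
  exact: differentiable_coord.
by apply/derivable1_diffP; have := is_derive_logistic_affine i (x 0 i); case.
Qed.

Lemma partial_logistic_coord i j : partial (logistic_coord i) j =
  cst (alpha ^+ 2 * (i == j)%:R) \*
    (logistic_coord i \* logistic_coord i \+ cst (-1) \* logistic_coord i).
Proof.
apply/funext => x; rewrite /partial.
have := @derive_line _ _ (logistic_coord i) x (delta_mx 0 j) 0.
rewrite scale0r addr0 => <-.
pose g (z : R) := logistic (alpha * (alpha * (z - beta i) - 1)).
pose h (e : R) := x 0 i + e * (i == j)%:R.
have dh : is_derive (0 : R) (1 : R) h (i == j)%:R.
  by apply: is_derive_eq; rewrite /GRing.scale/=; ring.
have dg := is_derive_logistic_affine i (h 0).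
have /= gh := @is_derive1_comp _ g h 0 _ _ dg dh.
rewrite (_ : (fun e => _) = g \o h); last first.
  by apply/funext => e; rewrite /= /logistic_coord /g /h !mxE eqxx.
rewrite (@derive_val _ _ _ _ _ _ _ gh) /h mul0r addr0 /logistic_coord/=; ring.
Qed.

Lemma smooth_bounded_logistic f :
  generated_algebra logistic_coord f -> smooth_bounded f.
Proof.
apply: generated_algebra_smooth_bounded => [i x|i j|i].
- exact: differentiable_logistic_coord.
- rewrite partial_logistic_coord.
  apply: generated_mul; first exact: generated_cst.
  apply: generated_add; apply: generated_mul; try exact: generated_gen.
  exact: generated_cst.
- exists 1 => x; rewrite ger0_norm; last first.
    by have /andP[] := logistic_itv (alpha * (alpha * (x 0 i - beta i) - 1)).
  by have /andP[] := logistic_itv (alpha * (alpha * (x 0 i - beta i) - 1)).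
Qed.

End logistic.

Section density.
Context {R : realType} {T : R}.
Variable P : probability (path_space T) R.

(** A pi-system generating the sigma-algebra of paths, whose members are limits of
    products of logistic functions. *)
Definition lower_orthants : set (set (path_space T)) :=
  [set A | exists m (u b : 'I_m -> R), (forall i, u i \in `[0, T]) /\
    A = [set w : path_space T | forall i, w (u i) <= b i]].

Lemma lower_orthantsI : setI_closed lower_orthants.
Proof.
move=> _ _ [m [u [b [u0T ->]]]] [n [v [c [v0T ->]]]].
exists (m + n)%N.
exists (fun i => match fintype.split i with inl j => u j | inr j => v j end).
exists (fun i => match fintype.split i with inl j => b j | inr j => c j end).
split; first by move=> i; case: fintype.split.
apply/seteqP; split => [w [ub vc] i|w h].
  by case: fintype.split => j.
split=> j; first by have := h (lshift n j); rewrite (unsplitK (inl j)).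
by have := h (rshift m j); rewrite (unsplitK (inr j)).
Qed.

Lemma lower_orthants_measurable : lower_orthants `<=` measurable.
Proof.
move=> _ [m [u [b [_ ->]]]].
rewrite (_ : mkset _ = \bigcap_(i in [set: 'I_m])
    ((fun w : path_space T => w (u i)) @^-1` `]-oo, b i]%classic)).
  apply: fin_bigcap_measurable => // i _; rewrite -[X in measurable X]setTI.
  exact: measurable_eval.
apply/seteqP; split=> w h i; first by move=> _; rewrite /= in_itv/=; exact: h.
by have := h i I; rewrite /= in_itv.
Qed.

Lemma measurable_lower_orthants :
  (measurable : set (set (path_space T))) = <<s lower_orthants >>.
Proof.
apply/seteqP; split; last first.
  by apply: smallest_sub; [exact: sigma_algebra_measurable|exact: lower_orthants_measurable].
apply: smallest_sub; first exact: smallest_sigma_algebra.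
move=> _ [x x0T [B mB ->]].
pose Om := g_sigma_algebraType lower_orthants.
suff : measurable_fun (setT : set Om) (fun w : Om => (w : path_space T) x : R).
  by move=> /(_ measurableT B mB); rewrite setTI.
apply: (measurability _ (RGenOInfty.measurableE R)).
move=> _ [_ [b ->] <-]; rewrite setTI.
rewrite -[X in measurable X]setCK; apply: measurableC; apply: sub_sigma_algebra.
exists 1%N, (fun=> x), (fun=> b); split=> //.
apply/seteqP; split=> w /=; rewrite in_itv/= andbT leNgt; first by move=> /negP.
by move=> /(_ ord0) /negP.
Qed.

Section orthogonal.
Variable Z : path_space T -> R.
Hypothesis iZ : P.-integrable setT (EFin \o Z).
Hypothesis Z_orth : forall F, smooth_cylindrical F -> (\int[P]_w (F w * Z w)%:E = 0)%E.

(** Dominated convergence along products of logistic functions of slope $N^2$. *)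
Let orth_lower_orthant A : lower_orthants A -> (\int[P]_(w in A) (Z w)%:E = 0)%E.
Proof.
move=> lA; have mA := lower_orthants_measurable lA.
case: lA mA => m [u [b [u0T ->]]]; set A0 := [set w | _] => mA.
pose F (N : nat) (y : 'rV[R]_m) := \prod_(i <- enum 'I_m) logistic_coord N%:R b i y.
have F01 N y : 0 <= F N y <= 1.
  rewrite prodr_ge0 ?prodr_ile1// => i _; last first.
    by have /andP[] := logistic_itv (N%:R * (N%:R * (y 0 i - b i) - 1)).
  exact: logistic_itv.
have Fcyl N : smooth_cylindrical (F N \o @coords R T m u).
  by exists m, u, (F N); split=> //; apply: smooth_bounded_logistic; exact: generated_prod.
have mF N : measurable_fun setT (F N \o @coords R T m u).
  apply: continuous_rV_measurable.
    by move=> i; under eq_fun do rewrite mxE; exact: measurable_eval.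
  have [dF _] := smooth_bounded_logistic (generated_prod (logistic_coord N%:R b) (enum 'I_m)) [::].
  by move=> x; apply: differentiable_continuous; exact: dF.
have Fcvg w : F N (coords u w) @[N --> \oo] --> (\1_A0 w : R).
  have -> : \1_A0 w = \prod_(i <- enum 'I_m) (w (u i) <= b i)%R%:R :> R.
    rewrite indicE; have [wA|wA] := boolP (w \in A0).
      by rewrite big1// => i _; move/set_mem : wA => /(_ i) ->.
    have /existsNP[i /negP wi] : ~ (forall i, w (u i) <= b i).
      by move=> h; move/negP : wA; apply; exact/mem_set.
    by rewrite big_enum (bigD1 i)//= (negbTE wi) mul0r.
  rewrite /F; elim: (enum _) => [|i r ih].
    by under eq_fun do rewrite big_nil; rewrite big_nil; exact: cvg_cst.
  under eq_fun do rewrite big_cons; rewrite big_cons; apply: cvgM => //.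
  rewrite /logistic_coord; under eq_fun do rewrite mxE; exact: logistic_cvg.
have mZ : measurable_fun setT Z by apply/measurable_EFinP; exact: measurable_int iZ.
have DC : (\int[P]_w (F N (coords u w) * Z w)%:E)%E @[N --> \oo] -->
    (\int[P]_w (\1_A0 w * Z w)%:E)%E.
  case: (@dominated_convergence _ _ _ P setT measurableT
    (fun N w => (F N (coords u w) * Z w)%:E) (fun w => (\1_A0 w * Z w)%:E)
    (fun w => `|(Z w)%:E|)%E) => //.
  - by move=> N; apply/measurable_EFinP/measurable_funM => //; exact: mF.
  - by apply/measurable_EFinP/measurable_funM => //; exact: measurable_indic.
  - apply: aeW => w _; apply: cvg_EFin; first exact: nearW.
    by apply: cvgM; [exact: Fcvg|exact: cvg_cst].
  - exact: integrable_abse.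
  - apply: aeW => w N _; rewrite !abse_EFin lee_fin normrM ler_piMl//.
    by have /andP[F0 F1] := F01 N (coords u w); rewrite ger0_norm.
rewrite integral_mkcond.
transitivity (\int[P]_w (\1_A0 w * Z w)%:E)%E.
  apply: eq_integral => w _; rewrite patchE indicE.
  by case: ifP => _; rewrite ?mul1r ?mul0r.
apply: cvg_unique DC _ => //.
rewrite [X in X @ _](_ : _ = fun=> 0%E); first exact: cvg_cst.
by apply/funext => N; exact: (Z_orth (Fcyl N)).
Qed.

(** The sets over which $Z$ has integral 0 form a Dynkin system containing the lower
    orthants, hence are all the measurable sets. *)
Lemma smooth_cylindrical_dense : \forall w \ae P, Z w = 0.
Proof.
have mZ : measurable_fun setT (EFin \o Z) by exact: measurable_int iZ.
have Q A : measurable A -> (\int[P]_(w in A) (Z w)%:E = 0)%E.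
  rewrite measurable_lower_orthants; move: A.
  have Z0 : (\int[P]_w (Z w)%:E = 0)%E.
    apply: orth_lower_orthant; exists 0%N, (fun=> 0), (fun=> 0); split=> [[]//|].
    by apply/seteqP; split=> // w _ [].
  apply: (dynkin_induction measurable_lower_orthants lower_orthantsI
    (P := fun A => (\int[P]_(w in A) (Z w)%:E = 0)%E)) => //.
  - move=> S mS S0; have := Z0; rewrite -(setvU S) integral_setU//=.
    + by rewrite S0 adde0.
    + exact: measurableC.
    + by rewrite setvU.
    + by rewrite disj_set2E setICl.
  - move=> F mF tF F0; rewrite integral_bigcup//.
      by rewrite eseries0.
    by apply: integrableS iZ => //; exact: bigcupT_measurable.
have : ae_eq P setT (EFin \o Z) (cst 0%E).
  apply: integral_ae_eq => //.
  by move=> E _ mE; rewrite integral0; exact: Q.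
by apply: filterS => w /(_ I) /= [].
Qed.

End orthogonal.
End density.

(** * Combinations of the paths min(r, .) are Cameron-Martin paths *)

(** The function [derive1] takes unspecified values at the kinks of a piecewise linear
    path and at the end points 0 and T; they are finitely many, so that neither
    measurability nor the integral is affected. *)
Section finite_exception.
Context {R : realType}.
Local Notation mu := (@lebesgue_measure R).
Variables (D E : set R) (f g : R -> \bar R).
Hypotheses (mD : measurable D) (fE : finite_set E).
Hypothesis fg : forall x, D x -> ~ E x -> f x = g x.
Hypothesis mg : measurable_fun D g.

Let finite_measurable (A : set R) : finite_set A -> measurable A.
Proof. by move=> /finite_set_countable; exact: countable_measurable. Qed.

Lemma measurable_fun_finite_exception : measurable_fun D f.
Proof.
rewrite -(setUIDK D E); apply/measurable_funU.
- by apply: measurableI => //; exact: finite_measurable.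
- by apply: measurableD => //; exact: finite_measurable.
split.
  move=> _ B mB; apply: finite_measurable.
  by apply: sub_finite_set fE => x [[]].
apply: (eq_measurable_fun g).
  by move=> x; rewrite inE => -[Dx Ex]; rewrite fg.
by apply: measurable_funS mg => // x [].
Qed.

Lemma integral_finite_exception : (\int[mu]_(x in D) f x = \int[mu]_(x in D) g x)%E.
Proof.
apply: ae_eq_integral => //; first exact: measurable_fun_finite_exception.
exists E; split.
- exact: finite_measurable.
- by apply: countable_lebesgue_measure0; exact: finite_set_countable.
- by move=> x /= /not_implyP[Dx fgx]; apply: contrapT => /(fg Dx).
Qed.

End finite_exception.

Lemma min_lipschitz (R : realType) (r a b : R) : a <= b ->
  `|Num.min r b - Num.min r a| <= b - a.
Proof.
move=> ab; rewrite ler_norml.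
by case: (leP r b) => rb; case: (leP r a) => ra; apply/andP; split; lra.
Qed.

Section cameron_martin_span.
Context {R : realType} {T : R}.
Hypothesis T_gt0 : 0 < T.
Variables (p : nat) (r : 'I_p -> R).
Hypothesis r0T : forall j, 0 <= r j <= T.

Definition span_path (c : 'I_p -> R) : path_space T := \sum_j c j *: min_path T (r j).

Lemma span_path_itv c x : 0 <= x <= T -> span_path c x = \sum_j c j * Num.min (r j) x.
Proof.
by move=> x0T; rewrite path_sumE; apply: eq_bigr => j _; rewrite pathZ min_path_itv.
Qed.

Lemma span_path_scale a c : a *: span_path c = span_path (fun j => a * c j).
Proof. by rewrite scaler_sumr; apply: eq_bigr => j _; rewrite scalerA. Qed.

Lemma span_path0 c : span_path c 0 = 0.
Proof.
rewrite span_path_itv ?lexx ?ltW// big1// => j _.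
by rewrite min_r ?mulr0//; case/andP: (r0T j).
Qed.

Lemma span_path_abs_continuous c : abs_continuous T (span_path c).
Proof.
move=> e e0; pose K := \sum_j `|c j|.
have K0 : 0 <= K by exact: sumr_ge0.
exists (e / (K + 1)); first by rewrite divr_gt0// ltr_wpDl.
move=> m a b ab _ abe.
have h i : `|span_path c (b i) - span_path c (a i)| <= K * (b i - a i).
  have [a0 aibi bT] := ab i.
  rewrite !span_path_itv ?a0 ?bT ?(le_trans a0) ?(le_trans _ bT)//.
  rewrite -sumrB (le_trans (ler_norm_sum _ _ _))// mulr_suml ler_sum// => j _.
  rewrite -mulrBr normrM ler_wpM2l//.
  exact: min_lipschitz.
rewrite (@le_lt_trans _ _ (\sum_i K * (b i - a i)))//; first exact: ler_sum.
rewrite -mulr_sumr; rewrite ltr_pdivlMr ?ltr_wpDl// in abe.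
rewrite (le_lt_trans _ abe)// mulrDr mulr1 mulrC lerDl sumr_ge0// => i _.
by have [_ aibi _] := ab i; rewrite subr_ge0.
Qed.

(** The derivative of [span_path c], away from the times $r_j$. *)
Definition span_density (c : 'I_p -> R) (x : R) : R := \sum_j c j * (x < r j)%R%:R.

Lemma measurable_span_density (D : set R) c : measurable_fun D (span_density c).
Proof.
apply: measurable_sum => j; apply: measurable_funM => //.
rewrite (_ : (fun _ => _) = \1_(`]-oo, r j[%classic)).
  exact: measurable_indic.
by apply/funext => x; rewrite indicE mem_setE/= in_itv.
Qed.

Lemma derive1_span_path c x : 0 < x < T -> (forall j, x != r j) ->
  derive1 (span_path c) x = span_density c x.
Proof.
move=> /andP[x0 xT] xr; rewrite derive1E.
pose l j (z : R) := if (x < r j)%R then z else r j.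
have dl j : is_derive x (1 : R) (l j) (x < r j)%R%:R.
  by rewrite /l; case: (x < r j); [exact: is_derive_id|exact: is_derive_cst].
have dL : is_derive x (1 : R) (fun z => \sum_j c j * l j z) (span_density c x).
  have -> : (fun z => \sum_j c j * l j z) = \sum_j (fun z => c j * l j z).
    by apply/funext => z; rewrite fct_sumE.
  have dj j : is_derive x (1 : R) (fun z => c j * l j z) (c j * (x < r j)%R%:R).
    by apply: is_derive_eq.
  exact: is_derive_sum.
rewrite -[RHS](@derive_val _ _ _ _ _ _ _ dL).
apply: near_eq_derive.
have near_r j : \forall z \near x, Num.min (r j) z = l j z.
  have := xr j; rewrite neq_lt /l => /orP[xj|xj].
    rewrite xj; near=> z; rewrite min_r//; apply: ltW; near: z; exact: lt_nbhsl.
  rewrite ltNge (ltW xj)/=; near=> z; rewrite min_l//; apply: ltW; near: z; exact: lt_nbhsr.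
have near_all : \forall z \near x, forall j, Num.min (r j) z = l j z.
  exact: (@filter_forall _ _ (fun j z => Num.min (r j) z = l j z) _ _ near_r).
near=> z.
have z0T : 0 <= z <= T.
  apply/andP; split; apply: ltW; near: z; [exact: lt_nbhsr|exact: lt_nbhsl].
rewrite span_path_itv//; apply: eq_bigr => j _; congr (_ * _).
by move: j; near: z.
Unshelve. all: by end_near. Qed.

Lemma cm_sqnorm_span_path c :
  cm_sqnorm T (span_path c) =
  (\int[lebesgue_measure]_(x in `[0%R, T]) (span_density c x ^+ 2)%:E)%E.
Proof.
apply: (@integral_finite_exception _ _ ([set 0] `|` [set T] `|` range r)) => //.
- rewrite !finite_setU; split; first by split; exact: finite_set1.
  by apply: finite_image.
- move=> x; rewrite /= in_itv/= => /andP[x0 xT] xE.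
  have x0' : 0 != x by apply/eqP => x0'; apply: xE; left; left.
  have xT' : x != T by apply/eqP => xT'; apply: xE; left; right.
  rewrite derive1_span_path//; first by rewrite !lt_neqAle x0 xT x0' xT'.
  by move=> j; apply/eqP => xj; apply: xE; right; exists j.
- by apply/measurable_EFinP/measurable_funX; exact: measurable_span_density.
Qed.

Lemma cm_sqnorm_span_path_lty c : (cm_sqnorm T (span_path c) < +oo)%E.
Proof.
rewrite cm_sqnorm_span_path; pose K := \sum_j `|c j|.
apply: (@le_lt_trans _ _ (\int[lebesgue_measure]_(x in `[0%R, T]) (K ^+ 2)%:E)%E).
  apply: ge0_le_integral => //.
  - by move=> x _; rewrite lee_fin sqr_ge0.
  - by apply/measurable_EFinP/measurable_funX; exact: measurable_span_density.
  - move=> x _; rewrite lee_fin -(real_normK (num_real (span_density c x))).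
    rewrite lerXn2r// ?nnegrE ?sumr_ge0//.
    rewrite (le_trans (ler_norm_sum _ _ _))// ler_sum// => j _.
    by rewrite normrM ler_piMr// ger0_norm//; case: (_ < _).
rewrite integral_cst//= lebesgue_measure_itv/= lte_fin T_gt0.
by rewrite -EFinB -EFinM ltry.
Qed.

Lemma cm_sqnorm_span_path_scale a c :
  cm_sqnorm T (a *: span_path c) = ((a ^+ 2)%:E * cm_sqnorm T (span_path c))%E.
Proof.
rewrite span_path_scale !cm_sqnorm_span_path -ge0_integralZl_EFin ?sqr_ge0//; last 2 first.
- by move=> x _; rewrite lee_fin sqr_ge0.
- by apply/measurable_EFinP/measurable_funX; exact: measurable_span_density.
apply: eq_integral => x _; rewrite -EFinM -exprMn /span_density mulr_sumr.
by congr ((_ ^+ 2)%:E); apply: eq_bigr => j _; rewrite mulrA.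
Qed.

Lemma cameron_martin_span_path c : cameron_martin (span_path c).
Proof.
split; first exact: span_path0.
- exact: span_path_abs_continuous.
- exact: cm_sqnorm_span_path_lty.
Qed.

End cameron_martin_span.

(** * The divergence of g(W_s) h *)

Section divergence.
Context {R : realType} {T : R}.
Hypothesis T_gt0 : 0 < T.
Variable P : probability (path_space T) R.
Hypothesis P_wiener : wiener_measure P.

Lemma expectationE (X : path_space T -> R) : ('E_P[X] = \int[P]_w (X w)%:E)%E.
Proof. by rewrite unlock. Qed.

Lemma malliavin_derive_coords k (u : 'I_k -> R) (f : 'rV[R]_k -> R) (h w : path_space T) :
  malliavin_derive (f \o coords u) h w = 'D_(coords u h) f (coords u w).
Proof.
rewrite /malliavin_derive derive1E.
rewrite (_ : (fun e => _) = fun e => f (coords u w + e *: coords u h)).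
  by rewrite derive_line scale0r addr0.
by apply/funext => e /=; congr (f _); apply/rowP => i; rewrite !mxE.
Qed.

Lemma smooth_cylindrical_moments F : smooth_cylindrical F -> all_moments P F.
Proof.
move=> [m [u [f [_ sf ->]]]]; have tf := smooth_bounded_tame sf.
have [_ pf _] := tf.
exact: (all_moments_coords P_wiener u (tame_continuous tf) pf).
Qed.

(** The difference of two divergences of the same process is orthogonal to all smooth
    cylindrical functionals. *)
Lemma is_divergence_unique Z X X' :
  is_divergence P Z X -> is_divergence P Z X' -> \forall w \ae P, X w = X' w.
Proof.
move=> [_ _ LX hX] [_ _ LX' hX'].
have P1 : P setT \is a fin_num by exact: fin_num_measure.
have i1 : P.-integrable setT (EFin \o X) by apply/Lfun1_integrable/(Lfun_subset12 P1).
have i2 : P.-integrable setT (EFin \o X') by apply/Lfun1_integrable/(Lfun_subset12 P1).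
have : \forall w \ae P, X w - X' w = 0.
  apply: smooth_cylindrical_dense => [|F cF].
    exact: (integrableB measurableT i1 i2).
  have LF := all_moments_Lfun (smooth_cylindrical_moments cF).
  have /Lfun1_integrable j1 := Lfun2_mul_Lfun1 LF LX.
  have /Lfun1_integrable j2 := Lfun2_mul_Lfun1 LF LX'.
  under eq_integral do rewrite mulrBr EFinB.
  rewrite integralB//.
  have [_ e1] := hX F cF; have [_] := hX' F cF; rewrite e1 !expectationE => ->.
  by rewrite subee//; exact: (integrable_fin_num measurableT j2).
by apply: filterS => w /eqP; rewrite subr_eq0 => /eqP.
Qed.

Section step.
Variables (n : nat) (s : 'I_n -> R).
Hypothesis s0T : forall i, 0 <= s i <= T.
Variable c : 'I_n -> R.
Let h := @span_path R T n s c.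
Variable g : 'rV[R]_n -> R.
Hypothesis tg : tame g.

(** The formula $\delta(g h) = g\, \delta(h) - D_h g$ as a function of the values at the
    times $s$, with $\delta(h) = \sum_j c_j W_{s_j}$. *)
Definition adjoint_derivative (y : 'rV[R]_n) :=
  g y * (\sum_j c j * y 0 j) - 'D_(coords s h) g y.

Let Mg : all_moments P (g \o coords s).
Proof.
have [_ pg _] := tg; exact: (all_moments_coords P_wiener s (tame_continuous tg) pg).
Qed.

Lemma adjoint_derivative_moments : all_moments P (adjoint_derivative \o coords s).
Proof.
have [_ _ /(_ (coords s h))[cD pD]] := tg.
rewrite (_ : _ \o _ = (fun w => g (coords s w) * (\sum_j c j * coords s w 0 j)) \+
    (cst (-1) \* ('D_(coords s h) g \o coords s))); last first.
  by apply/funext => w; rewrite /adjoint_derivative/= mulN1r.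
apply: all_momentsD; last first.
  by apply: all_momentsM; [exact: all_moments_cst|exact: (all_moments_coords P_wiener s cD pD)].
apply: all_momentsM => //; apply: all_moments_sum => j.
apply: all_momentsM; first exact: all_moments_cst.
by under eq_fun do rewrite mxE; exact: all_moments_eval.
Qed.

(** An almost sure equality is what is available for $G$, since the previous
    divergence in an iteration is known up to null sets. *)
Lemma is_divergence_span (G : path_space T -> R) : G \in Lfun P 2%:E ->
  (\forall w \ae P, G w = g (coords s w)) ->
  is_divergence P (fun w => G w *: h) (adjoint_derivative \o coords s).
Proof.
move=> LG Gg; have mG : measurable_fun setT G by move: LG; rewrite inE => /andP[/[!inE]].
split.
- by move=> w; rewrite span_path_scale; exact: cameron_martin_span_path.
- under eq_integral do rewrite cm_sqnorm_span_path_scale//.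
  have := cm_sqnorm_span_path_lty T_gt0 s c.
  have : (0 <= cm_sqnorm T (@span_path R T n s c))%E.
    by apply: integral_ge0 => x _; rewrite lee_fin sqr_ge0.
  case: (cm_sqnorm _ _) => // N N0 _.
  have iG := Lfun2_integrable_sqr LG.
  rewrite integralZr//.
  have /fineK <- := integrable_fin_num measurableT iG.
  by rewrite -EFinM ltry.
- exact: all_moments_Lfun adjoint_derivative_moments.
- move=> F [k [u [f [u0T sf ->]]]]; have tf := smooth_bounded_tame sf.
  have [df pf /(_ (coords u h))[cD pD]] := tf.
  have E w : malliavin_derive (f \o coords u) (G w *: h) w = G w * 'D_(coords u h) f (coords u w).
    rewrite malliavin_derive_coords -derive_scale//; congr ('D_ _ f _).
    by apply/rowP => i; rewrite !mxE.
  have MD : all_moments P (fun w => 'D_(coords u h) f (coords u w)).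
    exact: (all_moments_coords P_wiener u cD pD).
  have mGD : measurable_fun setT (fun w => G w * 'D_(coords u h) f (coords u w)).
    by apply: measurable_funM => //; case: MD.
  have aeGD : \forall w \ae P, G w * 'D_(coords u h) f (coords u w) =
      g (coords s w) * 'D_(coords u h) f (coords u w).
    by apply: filterS Gg => w ->.
  have MgD := all_momentsM Mg MD.
  rewrite expectationE; under [in X in _ /\ X]eq_integral do rewrite E.
  split.
    by under eq_fun do rewrite E; exact: (ae_integrable mGD aeGD (all_moments_integrable MgD)).
  rewrite (ae_integral_eq mGD _ aeGD); last by case: MgD.
  rewrite expectationE ibp_product//.
  apply: eq_integral => w _; rewrite /adjoint_derivative/=.
  by congr ((_ * (_ * _ - _))%:E); apply: eq_bigr => j _; rewrite mxE.
Qed.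

Lemma divergence_span (G : path_space T -> R) : G \in Lfun P 2%:E ->
  (\forall w \ae P, G w = g (coords s w)) ->
  divergence P (fun w => G w *: h) \in Lfun P 2%:E /\
  \forall w \ae P, divergence P (fun w => G w *: h) w = adjoint_derivative (coords s w).
Proof.
move=> LG Gg; have D := is_divergence_span LG Gg.
have D' : is_divergence P (fun w => G w *: h) (divergence P (fun w => G w *: h)).
  by rewrite /divergence; case: xgetP => [X _ //|/(_ (adjoint_derivative \o coords s))].
split; first by case: D'.
exact: is_divergence_unique D' D.
Qed.

End step.
End divergence.

(** * Full support, and uniqueness of the continuous conditional expectation *)

Section extend.
Context {V : nmodType} {n : nat}.
Implicit Type v : 'I_n -> V.

(** The sequence $0, v_0, v_1, \dots$; it is [prev_coord] with a natural number as
    argument, and it turns $s$ into a partition starting at 0. *)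
Definition extend0 v (k : nat) : V := \sum_(j < n | j.+1 == k) v j.

Lemma extend0_0 v : extend0 v 0 = 0.
Proof. by rewrite /extend0 big_pred0. Qed.

Lemma extend0_S v (i : 'I_n) : extend0 v i.+1 = v i.
Proof. by rewrite /extend0 (big_pred1 i)// => j; rewrite eqSS. Qed.

End extend.

Lemma normal_prob_ball_gt0 {R : realType} (sigma : R) (x e : R) : 0 < sigma -> 0 < e ->
  (0 < normal_prob 0 sigma (ball x e))%E.
Proof.
move=> s0 e0; rewrite lt_neqAle measure_ge0 andbT eq_sym; apply/eqP => N0.
have mb : measurable (ball x e) by exact: measurable_ball.
have mg : measurable_fun (ball x e) (EFin \o normal_pdf 0 sigma).
  by apply/measurable_EFinP/measurable_funTS; exact: measurable_normal_pdf.
have : ae_eq lebesgue_measure (ball x e) (EFin \o normal_pdf 0 sigma) (cst 0%E).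
  apply/ae_eq_integral_abs => //; rewrite -[RHS]N0; apply: eq_integral => z _.
  by rewrite /= ger0_norm// normal_pdf_ge0.
have pos z : 0 < normal_pdf 0 sigma z.
  by rewrite normal_pdfE ?gt_eqF// mulr_gt0 ?expR_gt0// normal_peak_gt0// gt_eqF.
move=> [A [mA A0 bA]].
have : (lebesgue_measure (ball x e) <= lebesgue_measure A)%E.
  apply: le_measure; rewrite ?inE// => z xz; apply: bA => /= /(_ xz) [] /eqP.
  by rewrite gt_eqF.
by rewrite A0 lebesgue_measure_ball ?(ltW e0)// lee_fin leNgt mulrn_wgt0.
Qed.

Section full_support.
Context {R : realType} {T : R}.
Hypothesis T_gt0 : 0 < T.
Variable P : probability (path_space T) R.
Hypothesis P_wiener : wiener_measure P.
Variables (n : nat) (s : 'I_n -> R).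
Hypothesis s_gt0 : forall i, 0 < s i.
Hypothesis s_incr : forall i j : 'I_n, (i < j)%N -> s i < s j.
Hypothesis s_leT : forall i, s i <= T.

Lemma time_grid_extend0 : @time_grid R T (extend0 s) n.
Proof.
split; first exact: extend0_0.
  case=> [|i] i_n.
    by rewrite extend0_0 (extend0_S s (Ordinal i_n)).
  rewrite (extend0_S s (Ordinal i_n)) (extend0_S s (Ordinal (ltnW i_n))).
  exact: s_incr.
case: n s s_leT => [|m] s' s'T; first by rewrite extend0_0 ltW.
by rewrite (extend0_S s' ord_max).
Qed.

(** If every increment of $W$ on $0 < s_1 < \dots < s_n$ is within $e / (n + 1)$ of the
    corresponding increment of $y$, then $W_s$ is within $e$ of $y$.  By independence this
    event has positive probability. *)
Lemma coords_open_gt0 (U : set 'rV[R]_n) y : open U -> U y ->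
  (0 < P (coords s @^-1` U))%E.
Proof.
move=> oU Uy.
have mU : measurable (coords s @^-1` U : set (path_space T)).
  apply: measurable_rV_open => // i.
  by under eq_fun do rewrite mxE; exact: measurable_eval.
have /nbhs_ballP[e /= e0 yeU] : nbhs y U by exact: open_nbhs_nbhs.
have tg := time_grid_extend0.
pose t := extend0 s; pose z := extend0 (y 0).
(* At most n increments add up, so that n + 1 leaves a strict inequality. *)
pose d := e / n.+1%:R; have d0 : 0 < d by rewrite divr_gt0.
pose B i := ball (z i.+1 - z i) d.
have mB i : measurable (B i) by exact: measurable_ball.
pose A := \bigcap_(i < n) (@increment R T t i @^-1` B i).
have A0 : (0 < P A)%E.
  rewrite /A (increments_indep P_wiener tg)//.
  elim/big_ind : _ => // [a b a0 b0|i _]; first by rewrite mule_gt0.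
  rewrite (increment_law P_wiener tg)// normal_prob_ball_gt0//.
  by rewrite sqrtr_gt0 subr_gt0; have [_ + _] := tg; apply.
have AU w : A w -> w 0 = 0 -> U (coords s w).
  move=> Aw w0; apply: yeU; split=> // i0 i; rewrite ord1 mxE.
  have ws : w (s i) = \sum_(b < i.+1) increment t b w.
    by rewrite (sum_increments tg) w0 subr0 /t extend0_S.
  have ys : y 0 i = \sum_(b < i.+1) (z b.+1 - z b).
    rewrite -(big_mkord xpredT (fun b => z b.+1 - z b)) telescope_sumr//.
    by rewrite /z extend0_0 subr0 extend0_S.
  rewrite /ball/= ws ys -sumrB (le_lt_trans (ler_norm_sum _ _ _))//.
  apply: (@le_lt_trans _ _ (\sum_(b < i.+1) d)).
    apply: ler_sum => b _; apply/ltW/(Aw b) => /=.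
    by rewrite (leq_trans (ltn_ord b)).
  rewrite sumr_const card_ord /d -(mulr_natr (e / _)) -mulrA gtr_pMr//.
  by rewrite mulrC ltr_pdivrMr// mul1r ltr_nat ltnS.
rewrite lt_neqAle measure_ge0 andbT eq_sym; apply/eqP => U0.
have : P.-negligible A.
  apply: (negligibleS (A := (coords s @^-1` U) `|` [set w | w 0 != 0])).
    move=> w Aw; have [w0|w0] := eqVneq (w 0) 0; last by right.
    by left; exact: AU.
  apply: negligibleU.
    by exists (coords s @^-1` U); split.
  have := ae_start0 P_wiener; rewrite /prop_near1 /almost_everywhere/=.
  by apply: negligibleS => w /= /eqP.
move=> [C [mC C0 AC]].
have : (P A <= P C)%E.
  apply: le_measure; rewrite ?inE//.
  apply: fin_bigcap_measurable => // i _; rewrite -[X in measurable X]setTI.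
  exact: measurable_increment.
by rewrite C0 leNgt A0.
Qed.

(** Two versions have the same integral over the preimage of the open set where
    $m_1 > m_2$, which is thus a null event, contradicting full support. *)
Lemma cond_exp_version_le X m1 m2 : continuous m1 -> continuous m2 ->
  cond_exp_version P X (coords s) m1 -> cond_exp_version P X (coords s) m2 ->
  forall y, m1 y <= m2 y.
Proof.
move=> c1 c2 [_ i1 e1] [_ i2 e2] y; rewrite leNgt; apply/negP => ylt.
pose U := (m1 \- m2) @^-1` [set x | 0 < x].
have oU : open U.
  apply: open_comp; last exact: open_gt.
  by move=> x _; exact: (cvgB (c1 x) (c2 x)).
have Uy : U y by rewrite /U/= subr_gt0.
have := coords_open_gt0 oU Uy.
set A := coords s @^-1` U => A0.
have mA : measurable A.
  apply: measurable_rV_open => // i.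
  by under eq_fun do rewrite mxE; exact: measurable_eval.
have sU : <<s [set U : set 'rV[R]_n | open U] >> U by exact: sub_sigma_algebra.
have j1 : P.-integrable A (EFin \o m1 \o coords s) by exact: integrableS i1.
have j2 : P.-integrable A (EFin \o m2 \o coords s) by exact: integrableS i2.
have E : (\int[P]_(w in A) ((m1 (coords s w))%:E - (m2 (coords s w))%:E) = 0)%E.
  rewrite integralB// -e1// -e2// subee// e1//.
  exact: (integrable_fin_num mA j1).
have : ae_eq P A (fun w => ((m1 (coords s w))%:E - (m2 (coords s w))%:E)%E) (cst 0%E).
  apply/ae_eq_integral_abs => //.
    by apply: measurable_int; exact: (integrableB mA j1 j2).
  rewrite -[RHS]E; apply: eq_integral => w; rewrite inE => Aw.
  by rewrite gee0_abs// -EFinB lee_fin ltW.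
move=> [C [mC C0 AC]].
have : (P A <= P C)%E.
  apply: le_measure; rewrite ?inE// => w Aw; apply: AC => /= /(_ Aw) [] /eqP.
  by rewrite gt_eqF.
by rewrite C0 leNgt A0.
Qed.

Lemma cond_exp_unique X m : continuous m ->
  cond_exp_version P X (coords s) m -> cond_exp P X (coords s) = m.
Proof.
move=> cm vm; rewrite /cond_exp; case: xgetP => [m' _ [cm' vm']|/(_ m)]; last by case.
apply/funext => y; apply/eqP; rewrite eq_le.
by rewrite !(cond_exp_version_le _ _ vm vm', cond_exp_version_le _ _ vm' vm).
Qed.

End full_support.

(** * Logarithmic derivative of Q *)

Section gaussian_density.
Context {R : realType}.
Variables (n : nat) (s : 'I_n -> R).
Hypothesis s_gt0 : forall i, 0 < s i.
Hypothesis s_incr : forall i j : 'I_n, (i < j)%N -> s i < s j.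

Local Notation sigma := (malliavin_cov s).
Implicit Types v w : 'I_n -> R.

Definition backward_diff v (i : 'I_n) : R := v i - prev_coord v i.

Local Notation z y i := (backward_diff (y 0) i).
Local Notation tau := (backward_diff s).

Lemma backward_diffE v i : backward_diff v i = extend0 v i.+1 - extend0 v i.
Proof. by rewrite extend0_S. Qed.

Lemma backward_diff_line (x v : 'rV[R]_n) e i : z (x + e *: v) i = z x i + e * z v i.
Proof.
rewrite /backward_diff /prev_coord !mxE.
under eq_bigr do rewrite !mxE.
rewrite big_split/= -mulr_sumr; ring.
Qed.

Lemma backward_diff_gt0 i : 0 < tau i.
Proof.
rewrite subr_gt0 /prev_coord; case: (posnP i) => [i0|i0].
  by rewrite big_pred0// => j; rewrite i0.
have i1n : (i.-1 < n)%N by rewrite (leq_ltn_trans (leq_pred i)).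
rewrite (big_pred1 (Ordinal i1n)) => [|j]; last by rewrite /= -val_eqE/= -{1}(prednK i0) eqSS.
by apply: s_incr => /=; rewrite prednK.
Qed.

Lemma sum_backward_diff v (k : 'I_n) : \sum_(i < n | (i <= k)%N) backward_diff v i = v k.
Proof.
under eq_bigr do rewrite backward_diffE.
rewrite (telescope_minn (extend0 v) n k.+1) (minn_idPr (ltn_ord k)).
by rewrite extend0_0 subr0 extend0_S.
Qed.

(** The increment of $s_k \wedge \cdot$ over $[s_{i-1}, s_i]$ is the full length up to
    $s_k$ and 0 afterwards. *)
Lemma backward_diff_min (k i : 'I_n) :
  backward_diff (fun j => Num.min (s k) (s j)) i = (i <= k)%N%:R * tau i.
Proof.
have s_le (a b : 'I_n) : (a <= b)%N -> s a <= s b.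
  rewrite leq_eqVlt => /predU1P[/val_inj ->//|ab]; exact: ltW (s_incr ab).
rewrite /backward_diff /prev_coord; case: (posnP i) => [i0|i0].
  rewrite !big_pred0 ?subr0 => [||j]; [|by move=> j; rewrite i0|by rewrite i0].
  by rewrite min_r ?s_le ?i0//= mul1r.
have i1n : (i.-1 < n)%N by rewrite (leq_ltn_trans (leq_pred i)).
have pE (j : 'I_n) : (j.+1 == i) = (j == Ordinal i1n).
  by rewrite -val_eqE/= -{1}(prednK i0) eqSS.
rewrite !(big_pred1 (Ordinal i1n))//.
case: leqP => ik.
  by rewrite !min_r ?mul1r// s_le//= (leq_trans (leq_pred _)).
by rewrite !min_l ?mul0r ?subrr// s_le ?(ltnW ik)//= -ltnS prednK.
Qed.

(** Polarization of the quadratic form in the exponent of $Q$. *)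
Definition energy (x y : 'rV[R]_n) : R := \sum_i z x i * z y i / tau i.

(** The factor $\tau_i$ in the increments of the rows of $\sigma$ cancels the denominators
    of the energy; the remaining increments of $y$ telescope. *)
Lemma energy_mul_cov (c y : 'rV[R]_n) : energy (c *m sigma) y = \sum_k c 0 k * y 0 k.
Proof.
have zc i : z (c *m sigma) i = \sum_k c 0 k * ((i <= k)%N%:R * tau i).
  have cE j : (c *m sigma) 0 j = \sum_k c 0 k * Num.min (s k) (s j).
    by rewrite mxE; apply: eq_bigr => k _; rewrite mxE.
  rewrite /backward_diff /prev_coord cE.
  under [X in _ - X]eq_bigr do rewrite cE.
  rewrite exchange_big/= -sumrB; apply: eq_bigr => k _.
  by rewrite -backward_diff_min /backward_diff /prev_coord mulrBr mulr_sumr.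
have E i : z (c *m sigma) i * z y i / tau i = \sum_k c 0 k * ((i <= k)%N%:R * z y i).
  rewrite zc -mulrA mulr_suml; apply: eq_bigr => k _.
  by field; rewrite gt_eqF// backward_diff_gt0.
rewrite /energy; under eq_bigr do rewrite E.
rewrite exchange_big/=; apply: eq_bigr => k _; rewrite -mulr_sumr; congr (_ * _).
rewrite -[RHS]sum_backward_diff [RHS]big_mkcond; apply: eq_bigr => i _.
by case: ifP => _; rewrite ?mul1r ?mul0r.
Qed.

(** If $c \sigma = 0$ then $c_k = \mathcal{E}(c \sigma, e_k) = 0$. *)
Lemma malliavin_cov_unit : sigma \in unitmx.
Proof.
rewrite -row_free_unit -kermx_eq0; apply/rowV0P => c /sub_kermxP c0.
apply/rowP => k; rewrite mxE.
have := energy_mul_cov c (delta_mx 0 k); rewrite c0.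
rewrite (bigD1 k)//= mxE !eqxx mulr1 big1 ?addr0; last first.
  by move=> j /negbTE jk; rewrite mxE jk andbF mulr0.
move=> <-; rewrite /energy big1// => i _.
rewrite /backward_diff /prev_coord mxE.
by under eq_bigr do rewrite mxE; rewrite big1_eq subrr !mul0r.
Qed.

(** The function $\ell_j = - \partial_j \log Q$, for which $\delta(h_j) = \ell_j(W_s)$. *)
Definition neg_score (j : 'I_n) (y : 'rV[R]_n) : R := \sum_i invmx sigma i j * y 0 i.

Lemma energy_delta_mx y j : energy y (delta_mx 0 j) = neg_score j y.
Proof.
rewrite -[in LHS](mulmxKV malliavin_cov_unit y) energy_mul_cov.
rewrite (bigD1 j)//= big1 ?addr0 => [|i /negbTE ij]; last first.
  by rewrite [delta_mx _ _ _ _]mxE ij andbF mulr0.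
rewrite [delta_mx _ _ _ _]mxE !eqxx mulr1 mxE.
by apply: eq_bigr => i _; rewrite mulrC.
Qed.

Definition heat_constant : R := \prod_i (Num.sqrt (2 * pi * tau i))^-1.

Lemma heat_constant_gt0 : 0 < heat_constant.
Proof.
apply: prodr_gt0 => i _; rewrite invr_gt0 sqrtr_gt0 mulr_gt0 ?backward_diff_gt0//.
by rewrite mulr_gt0 ?pi_gt0.
Qed.

Lemma QdensityE y : Qdensity s y = heat_constant * expR (- energy y y / 2).
Proof.
rewrite /Qdensity /heat_constant /energy mulrC -sumrN mulr_suml expR_sum -big_split/=.
apply: eq_bigr => i _; rewrite /heat_kernel -/(backward_diff s i) -/(backward_diff (y 0) i).
congr (expR _ * _); field; by rewrite gt_eqF// backward_diff_gt0.
Qed.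

Lemma Qdensity_neq0 y : Qdensity s y != 0.
Proof. by rewrite QdensityE mulf_neq0// gt_eqF ?heat_constant_gt0 ?expR_gt0. Qed.

Lemma energy_line (x v : 'rV[R]_n) e : energy (x + e *: v) (x + e *: v) =
  energy x x + 2 * e * energy x v + e ^+ 2 * energy v v.
Proof.
rewrite /energy !mulr_sumr -!big_split/=; apply: eq_bigr => i _.
rewrite backward_diff_line; ring.
Qed.

Lemma partial_Qdensity j y : partial (Qdensity s) j y = - neg_score j y * Qdensity s y.
Proof.
rewrite /partial; have := derive_line (Qdensity s) y (delta_mx 0 j) 0.
rewrite scale0r addr0 => <-.
set v := delta_mx 0 j.
under eq_fun do rewrite QdensityE energy_line.
rewrite QdensityE -energy_delta_mx -/v.
set a := energy y y; set b := energy y v; set d := energy v v; set C := heat_constant.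
pose q (e : R) := - (a + 2 * e * b + e ^+ 2 * d) / 2.
have dq : is_derive (0 : R) (1 : R) q (- b).
  by apply: is_derive_eq; rewrite /GRing.scale/=; field.
have dE := @is_derive1_comp _ expR q 0 _ _ (is_derive_expR _) dq.
have dCE := is_deriveZ C dE.
rewrite (_ : (fun e => _) = C \*: (expR \o q))// (@derive_val _ _ _ _ _ _ _ dCE).
rewrite /GRing.scale/= /q mulr0 mul0r expr0n/= mul0r !addr0; ring.
Qed.

Lemma generated_energy : generated_algebra coordinate (fun y => energy y y).
Proof.
have zi i : generated_algebra coordinate (fun y => z y i).
  rewrite (_ : (fun _ => _) = coordinate i \+ (cst (-1) \*
      (fun y => \sum_(j < n | j.+1 == i) coordinate j y))); last first.
    by apply/funext => y; rewrite /= mulN1r.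
  apply: generated_add; first exact: generated_gen.
  apply: generated_mul; first exact: generated_cst.
  by apply: generated_sum => j; exact: generated_gen.
apply: generated_sum => i; apply: generated_mul; last exact: (generated_cst _ (tau i)^-1).
exact: generated_mul.
Qed.

Lemma differentiable_Qdensity y : differentiable (Qdensity s) y.
Proof.
have -> : Qdensity s = (fun x : R => heat_constant * expR (- x / 2)) \o (fun y => energy y y).
  by apply/funext => x; rewrite QdensityE.
apply: differentiable_comp; first exact: differentiable_polynomial generated_energy.
exact/derivable1_diffP.
Qed.

End gaussian_density.

(** * The common recursion *)

Section iterated_divergence.
Context {R : realType} {T : R}.
Hypothesis T_gt0 : 0 < T.
Variable P : probability (path_space T) R.
Hypothesis P_wiener : wiener_measure P.
Variables (n : nat) (s : 'I_n -> R).
Hypothesis s_gt0 : forall i, 0 < s i.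
Hypothesis s_incr : forall i j : 'I_n, (i < j)%N -> s i < s j.
Hypothesis s_leT : forall i, s i <= T.

Let s0T i : 0 <= s i <= T.
Proof. by rewrite ltW// s_leT. Qed.

(** $h_j(s_k) = (\sigma \sigma^{-1})_{kj}$; so differentiating along $h_j$ is
    differentiating in the $j$-th variable. *)
Lemma coords_dual_path j : coords s (dual_path T s j) = delta_mx 0 j.
Proof.
apply/rowP => k; rewrite mxE [RHS]mxE eqxx/=.
have := congr1 (fun A : 'M[R]_n => A k j) (mulmxV (malliavin_cov_unit s_gt0 s_incr)).
rewrite !mxE => <-; rewrite path_sumE; apply: eq_bigr => i _.
by rewrite pathZ min_path_itv// mxE mulrC minC.
Qed.

Definition divergence_step (g : 'rV[R]_n -> R) (j : 'I_n) (y : 'rV[R]_n) : R :=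
  g y * neg_score s j y - partial g j y.

Lemma divergence_stepE g j :
  @adjoint_derivative R T n s (fun i => invmx (malliavin_cov s) i j) g = divergence_step g j.
Proof.
apply/funext => y; rewrite /adjoint_derivative /divergence_step.
by have := coords_dual_path j; rewrite /dual_path /span_path => ->.
Qed.

Lemma generated_divergence_step g j :
  generated_algebra (@coordinate R n) g ->
  generated_algebra (@coordinate R n) (divergence_step g j).
Proof.
move=> Gg; have dF i x : differentiable (@coordinate R n i) x by exact: differentiable_coord.
have [_ Gp] := generated_algebra_partial dF (@polynomial_coordinate_partial R n) Gg.
rewrite (_ : divergence_step _ _ = (g \* neg_score s j) \+ (cst (-1) \* partial g j)); last first.
  by apply/funext => y; rewrite /divergence_step/= mulN1r.
apply: generated_add; apply: generated_mul => //; last exact: generated_cst.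
apply: generated_sum => i; apply: generated_mul; first exact: generated_cst.
exact: generated_gen.
Qed.

Lemma generated_divergence_steps g l :
  generated_algebra (@coordinate R n) g ->
  generated_algebra (@coordinate R n) (foldl divergence_step g l).
Proof. by elim: l g => //= j l ih g Gg; exact/ih/generated_divergence_step. Qed.

Lemma iterated_divergence_ae (l : seq 'I_n) G g : G \in Lfun P 2%:E ->
  generated_algebra (@coordinate R n) g ->
  (\forall w \ae P, G w = g (coords s w)) ->
  let X := foldl (fun G j => divergence P (fun w => G w *: dual_path T s j)) G l in
  X \in Lfun P 2%:E /\ \forall w \ae P, X w = foldl divergence_step g l (coords s w).
Proof.
elim: l G g => [//|j l ih] G g LG Gg GE /=.
have [LX XE] := divergence_span T_gt0 P_wiener s0T (fun i => invmx (malliavin_cov s) i j)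
  (polynomial_tame Gg) LG GE.
apply: ih; first exact: LX.
  exact: generated_divergence_step.
by apply: filterS XE => w; rewrite divergence_stepE.
Qed.

(** $\partial_j (g Q) = (\partial_j g - g\, \ell_j) Q$; the constant $c$ collects the
    signs along the induction. *)
Lemma partials_Qdensity (l : seq 'I_n) g (c : R) :
  generated_algebra (@coordinate R n) g ->
  partials (fun y => c * g y * Qdensity s y) l =
  fun y => c * (-1) ^+ size l * foldl divergence_step g l y * Qdensity s y.
Proof.
elim: l g c => [|j l ih] g c Gg /=; first by apply/funext => y; rewrite mulr1.
have dg x : differentiable g x by exact: differentiable_polynomial.
have dQ x := differentiable_Qdensity s_gt0 s_incr x.
rewrite (_ : partial _ j = fun y => (- c) * divergence_step g j y * Qdensity s y).
  rewrite ih; last exact: generated_divergence_step.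
  by apply/funext => y; rewrite exprS mulN1r mulrN mulNr.
apply/funext => y; rewrite /partial.
have -> : (fun y => c * g y * Qdensity s y) = (cst c \* g) \* Qdensity s by [].
have dc : differentiable (cst c : 'rV[R]_n -> R) y by exact: differentiable_cst.
have dcg : differentiable (cst c \* g) y.
  by apply: differentiableM => //; exact: differentiable_cst.
rewrite (derive_mul _ dcg (dQ y)) (derive_mul _ dc (dg y)).
rewrite derive_cst -[X in _ + _ * X]/(partial (Qdensity s) j y) partial_Qdensity//.
rewrite /divergence_step /partial/=; ring.
Qed.

Lemma Lambda_cond_exp : cond_exp P (Lambda P s) (coords s) =
  foldl divergence_step (cst 1) (enum 'I_n).
Proof.
have G1 : generated_algebra (@coordinate R n) (cst 1) by exact: generated_cst.
have := @iterated_divergence_ae (enum 'I_n) (cst 1) (cst 1) (Lfun_cst _ _ _) G1.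
case; first exact: nearW.
rewrite -/(Lambda P s); set p := foldl divergence_step _ _ => LX XE.
have Gp : generated_algebra (@coordinate R n) p by exact: generated_divergence_steps.
have tp := polynomial_tame Gp; have cp := tame_continuous tp.
have [_ pp _] := tp.
have Mp := all_moments_coords P_wiener s cp pp.
have ip := all_moments_integrable Mp.
have P1 : P setT \is a fin_num by exact: fin_num_measure.
have iX : P.-integrable setT (EFin \o Lambda P s).
  by apply/Lfun1_integrable/(Lfun_subset12 P1).
apply: (cond_exp_unique T_gt0 P_wiener s_gt0 s_incr s_leT) => //.
split=> // B sB.
have mB : measurable (coords s @^-1` B : set (path_space T)).
  apply: measurable_rV_borel sB => i.
  by under eq_fun do rewrite mxE; exact: measurable_eval.
apply: ae_eq_integral => //.
- by apply: measurable_funTS; exact: measurable_int iX.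
- by apply: measurable_funTS; exact: measurable_int ip.
- by apply: filterS XE => w E _; rewrite E.
Qed.

End iterated_divergence.

Theorem theorem2p3 (R : realType) (T : R) (T_gt0 : 0 < T)
    (P : probability (path_space T) R) (P_wiener : wiener_measure P)
    (n : nat) (n_gt0 : (0 < n)%N) (s : 'I_n -> R) (t : R)
    (s_gt0 : forall i, 0 < s i)
    (s_incr : forall i j : 'I_n, (i < j)%N -> s i < s j)
    (s_lt_t : forall i, s i < t) (t_le_T : t <= T)
    (y : 'rV[R]_n) :
  (Qdensity s y)^-1 * partials (Qdensity s) (enum 'I_n) y =
  (-1) ^+ n * cond_exp P (Lambda P s) (coords s) y.
Proof.
have s_leT i : s i <= T by exact: le_trans (ltW (s_lt_t i)) t_le_T.
rewrite (Lambda_cond_exp T_gt0 P_wiener s_gt0 s_incr s_leT).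
have G1 : generated_algebra (@coordinate R n) (cst 1) by exact: generated_cst.
have := partials_Qdensity s_gt0 s_incr (enum 'I_n) 1 G1.
rewrite (_ : (fun y => 1 * cst 1 y * Qdensity s y) = Qdensity s); last first.
  by apply/funext => x; rewrite /= !mul1r.
move=> ->; rewrite mul1r size_enum_ord mulrC mulfK//.
exact: (Qdensity_neq0 s_gt0 s_incr).
Qed.
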